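(* Let $H$ be a complex Hilbert space and let $\lambda\in[0,1]$. For every $T\in\mathcal{B}(H)$ there exists $\theta\in\mathbb{R}$ such that for all natural numbers $n$, $$r(T)=\inf\{w(\operatorname{Re}(\Delta_\lambda^n(e^{i\theta}XTX^{-1}))) : X\in\mathcal{B}(H)\text{ invertible}\}=\inf\{\|\operatorname{Re}(\Delta_\lambda^n(e^{i\theta}XTX^{-1}))\| : X\in\mathcal{B}(H)\text{ invertible}\}.$$
   Context: $H$ is a (nonzero) complex Hilbert space, $\mathcal{B}(H)$ is the space of bounded linear operators on $H$ with the operator norm $\|\cdot\|$, and $r(T)$ is the spectral radius of $T$. For $S\in\mathcal{B}(H)$, $\operatorname{Re}(S)=\frac12(S+S^* )$. The numerical range of $S$ is $W(S)=\{\langle Sx,x\rangle : \|x\|=1\}$ and its numerical radius is $w(S)=\sup\{|\mu| : \mu\in W(S)\}$. For $T\in\mathcal{B}(H)$, $|T|=(T^*T)^{1/2}$ and $T=U|T|$ is the unique polar decomposition, with $U$ the partial isometry satisfying $\ker U=\ker T$. For $\lambda\in[0,1]$ the $\lambda$-Aluthge transform is $\Delta_\lambda(T)=|T|^{\lambda}U|T|^{1-\lambda}$, with the convention $|T|^0=I$, so that $\Delta_0(T)=U|T|=T$ and $\Delta_1(T)=|T|U$. Its iterates are $\Delta_\lambda^0(T)=T$ and $\Delta_\lambda^{n+1}(T)=\Delta_\lambda(\Delta_\lambda^n(T))$. Natural numbers include $0$. *)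

(* Defs.v *)
From HB Require Import structures.
From mathcomp Require Import all_boot all_order all_algebra.
From mathcomp Require Import sesquilinear complex.
From mathcomp Require Import all_classical all_reals all_analysis.

Set Implicit Arguments.
Unset Strict Implicit.
Unset Printing Implicit Defensive.

Import Order.TTheory GRing.Theory Num.Theory.
Import numFieldNormedType.Exports.

Local Open Scope classical_set_scope.
Local Open Scope ring_scope.
Local Open Scope complex_scope.

(* Norms over the field R[i] are R[i]-valued; [cnorm] is the same number in R. *)
Definition cnorm (R : realType) (V : normedZmodType R[i]) (x : V) : R :=
  complex.Re `|x|.

Definition expi (R : realType) (t : R) : R[i] := cos t +i* sin t.

Section BoundedOperators.
Context {R : realType} {H : completeNormedModType R[i]}.
Implicit Types (A B S T U X Y : H -> H) (f : R -> R).

(* B(H), as a set of functions H -> H. *)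
Definition bounded_op : set (H -> H) :=
  [set T | linear T /\ exists M : R, forall x, cnorm (T x) <= M * cnorm x].

Definition opnorm T : R := sup [set cnorm (T x) | x in [set x | cnorm x <= 1]].

Definition is_inverse X : set (H -> H) :=
  [set Y | bounded_op Y /\ X \o Y = idfun /\ Y \o X = idfun].

Definition invertible : set (H -> H) :=
  [set X | bounded_op X /\ exists Y, is_inverse X Y].

(* Only meaningful when [X] is invertible. *)
Definition op_inv X : H -> H := xget X (is_inverse X).

Definition spectrum T : set R[i] :=
  [set z | ~ invertible (fun x => T x - z *: x)].

Definition spectral_radius T : R := sup [set cnorm z | z in spectrum T].

Definition poly_op (p : {poly R}) A : H -> H :=
  fun x => \sum_(i < size p) (p`_i)%:C *: iter i A x.

(* The continuous functional calculus at a self-adjoint [A]: f(A) is the limit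
   in operator norm of p_n(A) for polynomials p_n converging to f uniformly on
   the (real) spectrum of A.  It is the only such limit because
   ||p(A)|| = sup of |p| over the spectrum. *)
Definition is_fun_calc f A : set (H -> H) :=
  [set B | bounded_op B /\ exists p : nat -> {poly R},
    (forall e : R, 0 < e -> \forall n \near \oo,
       forall t : R, spectrum A t%:C -> `|(p n).[t] - f t| <= e) /\
    opnorm (fun x => poly_op (p n) A x - B x) @[n --> \oo] --> (0 : R)].

Definition fun_calc f A : H -> H := xget A (is_fun_calc f A).

(* A^s for [A] positive and [s >= 0]; [0 `^ 0 = 1], so [A^0] is the identity. *)
Definition op_pow A (s : R) : H -> H := fun_calc (fun t => t `^ s) A.

(* The inner product is linear on the left and conjugate-linear on the right. *)
Variable dot : {dot H for Num.conj}.

Definition is_adjoint T : set (H -> H) :=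
  [set S | bounded_op S /\ forall x y, dot (T x) y = dot x (S y)].

Definition adjoint T : H -> H := xget T (is_adjoint T).

Definition re_op S : H -> H := fun x => 2^-1 *: (S x + adjoint S x).

Definition numerical_range S : set R[i] :=
  [set dot (S x) x | x in [set x | cnorm x = 1]].

Definition numerical_radius S : R :=
  sup [set cnorm mu | mu in numerical_range S].

Definition modulus T : H -> H := op_pow (adjoint T \o T) 2^-1.

Definition partial_isometry U : Prop :=
  bounded_op U /\
  forall x, (forall y, U y = 0 -> dot x y = 0) -> cnorm (U x) = cnorm x.

Definition is_polar T : set (H -> H) :=
  [set U | [/\ partial_isometry U, T = U \o modulus T &
               forall x, U x = 0 <-> T x = 0]].

Definition polar_isometry T : H -> H := xget T (is_polar T).

Definition aluthge (lam : R) T : H -> H :=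
  op_pow (modulus T) lam \o polar_isometry T \o op_pow (modulus T) (1 - lam).

End BoundedOperators.

(* Main.v *)
(* Choose theta so that r = r(T) lies in the spectrum of e^(i theta) T.

   Lower bound.  The products AB and BA have the same nonzero spectrum, hence so
   do S = U |S|^(1-lam) |S|^lam and its Aluthge transform |S|^lam U |S|^(1-lam).
   Thus r, if nonzero, is in the spectrum of every D occurring in the theorem,
   and if w(Re D) < r then D - r is coercive, hence invertible by Lax-Milgram.

   Upper bound.  The Aluthge transform does not increase the norm, so it is
   enough to find, for each rho > r(T), some X with ||X T X^-1|| <= rho (Rota).
   If ||T^n|| <= rho^n, the square root X of the positive operator
   \sum_(j < n) rho^(-2j) (T^j)^* T^j does.  Such an n is obtained without complex
   analysis, following Rickart: the resolvents (1 - z T)^-1 are uniformly close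
   for nearby z in the disc |z| <= 1/rho, and averaging them over the 2^k-th roots
   of unity shows that smallness of (s T)^(2^k) propagates from s = 0 to
   s = 1/rho in finitely many steps. *)

(* Both infima come from one chain, r <= w(Re D) <= ||Re D|| <= ||D||, valid for every invertible
   [X] and brought down to any rho > r by one [X]. The obstacle is that adjoints, powers and polar
   factors are picked by [xget]: nothing is known of them until some operator with the defining
   property is exhibited. These existence proofs rest on orthogonal projection, through Riesz
   representation and through the criterion that an operator bounded below with dense range is
   invertible. Powers need ||p(A)|| to be bounded by |p| on the spectrum, which in turn needs a
   nonempty spectrum; that, like Rota's bound, comes from propagating contraction through the disc.
   The spectral value that theta rotates to r exists because otherwise the resolvents would be
   uniformly bounded on the circle |z| = r, and spectral values could not come near it. *)
Require Import Defs.
From HB Require Import structures.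
From mathcomp Require Import all_boot all_order all_algebra.
From mathcomp Require Import sesquilinear complex.
From mathcomp Require Import all_classical all_reals all_analysis.
From mathcomp Require Import ring lra.

Set Implicit Arguments.
Unset Strict Implicit.
Unset Printing Implicit Defensive.

Import Order.TTheory GRing.Theory Num.Theory.
Import numFieldNormedType.Exports.

Local Open Scope classical_set_scope.
Local Open Scope ring_scope.
Local Open Scope complex_scope.

(** * Real-valued norms and polar coordinates *)

Section ComplexNorm.
Context {R : realType}.

Lemma normE (V : normedZmodType R[i]) (x : V) : `|x| = (cnorm x)%:C.
Proof. by rewrite /cnorm RRe_real. Qed.

Lemma cnorm_ge0 (V : normedZmodType R[i]) (x : V) : 0 <= cnorm x.
Proof. by rewrite -ler0c -normE. Qed.

Lemma cnorm_eq0 (V : normedZmodType R[i]) (x : V) : (cnorm x == 0) = (x == 0).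
Proof.
by rewrite -(inj_eq (@complexI R)) -normE (_ : 0%:C = 0 :> R[i]) // normr_eq0.
Qed.

Lemma cnorm0 (V : normedZmodType R[i]) : cnorm (0 : V) = 0.
Proof. by apply/eqP; rewrite cnorm_eq0. Qed.

Lemma ler_cnormD (V : normedZmodType R[i]) (x y : V) :
  cnorm (x + y) <= cnorm x + cnorm y.
Proof. by rewrite -lecR rmorphD /= -!normE ler_normD. Qed.

Lemma cnormN (V : normedZmodType R[i]) (x : V) : cnorm (- x) = cnorm x.
Proof. by rewrite /cnorm normrN. Qed.

Lemma cnorm_distC (V : normedZmodType R[i]) (x y : V) :
  cnorm (x - y) = cnorm (y - x).
Proof. by rewrite /cnorm distrC. Qed.

Lemma ler_cnormB (V : normedZmodType R[i]) (x y : V) :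
  cnorm (x - y) <= cnorm x + cnorm y.
Proof. by rewrite -(cnormN y) ler_cnormD. Qed.

Lemma lerB_cnorm (V : normedZmodType R[i]) (x y : V) :
  cnorm x - cnorm y <= cnorm (x - y).
Proof. by rewrite lerBlDr -{1}(subrK y x) ler_cnormD. Qed.

Lemma ler_cnorm_dist (V : normedZmodType R[i]) (z x y : V) :
  cnorm (x - y) <= cnorm (x - z) + cnorm (z - y).
Proof. by rewrite -{1}(subrK z x) -addrA ler_cnormD. Qed.

Lemma cnormZ (V : normedModType R[i]) (a : R[i]) (x : V) :
  cnorm (a *: x) = cnorm a * cnorm x.
Proof. by apply: (@complexI R); rewrite rmorphM /= -!normE normrZ. Qed.

Lemma cnormM (a b : R[i]) : cnorm (a * b) = cnorm a * cnorm b.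
Proof. by apply: (@complexI R); rewrite rmorphM /= -!normE normrM. Qed.

Lemma cnormV (a : R[i]) : cnorm a^-1 = (cnorm a)^-1.
Proof. by apply: (@complexI R); rewrite fmorphV /= -!normE normfV. Qed.

Lemma cnorm1 : cnorm (1 : R[i]) = 1.
Proof. by rewrite /cnorm normr1. Qed.

Lemma cnorm_real (t : R) : cnorm t%:C = `|t|.
Proof. by rewrite /cnorm normc_def /= expr0n addr0 sqrtr_sqr. Qed.

Lemma normr_Re_le (a : R[i]) : `|complex.Re a| <= cnorm a.
Proof. by rewrite -lecR -normE normc_ge_Re. Qed.

Lemma Re_le_cnorm (a : R[i]) : complex.Re a <= cnorm a.
Proof. exact: le_trans (ler_norm _) (normr_Re_le _). Qed.

Lemma conjcM (a b : R[i]) : conjc (a * b) = conjc a * conjc b.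
Proof. exact: rmorphM. Qed.

Lemma ReN (a : R[i]) : complex.Re (- a) = - complex.Re a.
Proof. by case: a. Qed.

Lemma ReD (a b : R[i]) : complex.Re (a + b) = complex.Re a + complex.Re b.
Proof. by case: a b => a1 a2 []. Qed.

Lemma cnorm_sqrE (a : R[i]) :
  cnorm a ^+ 2 = complex.Re a ^+ 2 + complex.Im a ^+ 2.
Proof. by apply: (@complexI R); rewrite rmorphXn /= -normE -add_Re2_Im2. Qed.

Lemma mulJ_cnorm (a : R[i]) : conjc a * a = (cnorm a ^+ 2)%:C.
Proof. by rewrite rmorphXn /= -normE sqr_normc mulrC. Qed.

Lemma normr_Im_le (a : R[i]) : `|complex.Im a| <= cnorm a.
Proof.
rewrite -(@ler_pXn2r _ 2) ?nnegrE ?cnorm_ge0//.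
by rewrite real_normK ?num_real// cnorm_sqrE lerDr sqr_ge0.
Qed.

Lemma cnorm_expi (t : R) : cnorm (expi t) = 1.
Proof. by rewrite /cnorm normc_def /= cos2Dsin2 sqrtr1. Qed.

Lemma expiV (t : R) : expi (- t) * expi t = 1.
Proof.
have := cos2Dsin2 t; rewrite /expi cosN sinN; simpc => h.
by apply/eqP; rewrite eq_complex /=; apply/andP; split; apply/eqP; nra.
Qed.

(** The angle is confined to a closed interval so that a disc becomes the image of a compact
    rectangle, as [resolvent_lower_bound] requires. [acos] gives the angle up to sign, and the sign
    of the imaginary part decides. *)
Lemma polar_form (z : R[i]) :
  exists2 t, - pi <= t <= pi & z = (cnorm z)%:C * expi t.
Proof.
have [->|z0] := eqVneq z 0.
  exists 0; last by rewrite cnorm0 mul0r.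
  by rewrite oppr_le0 !pi_ge0.
have n0 : 0 < cnorm z by rewrite lt_def cnorm_eq0 z0 cnorm_ge0.
have zE := cnorm_sqrE z.
case: z zE n0 {z0} => a b /=; set r := cnorm _ => rE r0.
have a1 : -1 <= a / r <= 1.
  by rewrite -ler_norml normrM normfV (gtr0_norm r0) ler_pdivrMr// mul1r;
    exact: (normr_Re_le (a +i* b)).
have cE : cos (acos (a / r)) = a / r by rewrite acosK// in_itv.
have sE : sin (acos (a / r)) = `|b| / r.
  rewrite sin_acos// -[RHS]ger0_norm ?divr_ge0// ?ltW// -sqrtr_sqr; congr Num.sqrt.
  rewrite !exprMn real_normK ?num_real// exprVn.
  apply: (mulIf (lt0r_neq0 (exprn_gt0 2 r0))); rewrite mulrBl !mulfVK ?expf_eq0 ?gt_eqF//.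
  by rewrite mul1r rE; ring.
have t0 := acos_ge0 a1; have tpi := acos_lepi a1.
have [b0|b0] := leP 0 b.
- exists (acos (a / r)); first by rewrite tpi andbT (le_trans _ t0)// oppr_le0 pi_ge0.
  rewrite /expi cE sE ger0_norm//; simpc.
  by congr (_ +i* _); field; rewrite gt_eqF.
- exists (- acos (a / r)); first by rewrite lerN2 tpi/= (le_trans _ (pi_ge0 _))// oppr_le0.
  rewrite /expi cosN sinN cE sE ltr0_norm//; simpc.
  by congr (_ +i* _); field; rewrite gt_eqF.
Qed.

End ComplexNorm.

(** * Inner product identities and Cauchy-Schwarz *)

Section InnerProduct.
Context {R : realType} {H : completeNormedModType R[i]}.
Variable dot : {dot H for Num.conj}.
Hypothesis norm_dot : forall x : H, `|x| ^+ 2 = dot x x.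

Lemma dotC (x y : H) : dot x y = conjc (dot y x).
Proof. by rewrite hermC /= expr0 mul1r. Qed.

Lemma dotZr (a : R[i]) (x y : H) : dot x (a *: y) = conjc a * dot x y.
Proof. by rewrite linearZr_LR. Qed.

Lemma dotZl (a : R[i]) (x y : H) : dot (a *: x) y = a * dot x y.
Proof. by rewrite linearZl_LR. Qed.

Lemma dotxx (x : H) : dot x x = (cnorm x ^+ 2)%:C.
Proof. by rewrite rmorphXn /= -normE norm_dot. Qed.

Lemma cnorm_sqrD (x y : H) :
  cnorm (x + y) ^+ 2 = cnorm x ^+ 2 + cnorm y ^+ 2 + 2 * complex.Re (dot x y).
Proof.
apply: (@complexI R); rewrite -dotxx linearDl !linearDr /= !dotxx.
have e : (2 * complex.Re (dot x y))%:C = dot x y + conjc (dot x y).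
  by rewrite addcJ rmorphM rmorph_nat.
by rewrite (dotC y x) !rmorphD /= e; ring.
Qed.

Lemma cnorm_sqrB (x y : H) :
  cnorm (x - y) ^+ 2 = cnorm x ^+ 2 + cnorm y ^+ 2 - 2 * complex.Re (dot x y).
Proof. by rewrite cnorm_sqrD cnormN linearNr /= ReN mulrN. Qed.

Lemma parallelogram (x y : H) :
  cnorm (x + y) ^+ 2 + cnorm (x - y) ^+ 2 = 2 * (cnorm x ^+ 2 + cnorm y ^+ 2).
Proof. rewrite cnorm_sqrD cnorm_sqrB; ring. Qed.

(** At t = 1 / ||y||^2 the last bracket equals t, and nonnegativity of the left side is Bessel's
    inequality for one vector. Cauchy-Schwarz and [orthogonal_projection] both use this value. *)
Lemma cnorm_sqr_subZ (t : R) (x y : H) :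
  cnorm (x - (t%:C * dot x y) *: y) ^+ 2 =
  cnorm x ^+ 2 - cnorm (dot x y) ^+ 2 * (2 * t - t ^+ 2 * cnorm y ^+ 2).
Proof.
rewrite cnorm_sqrB cnormZ cnormM cnorm_real dotZr conjcM.
rewrite conjc_real -(mulrA t%:C) mulJ_cnorm -rmorphM.
by rewrite !exprMn real_normK ?num_real// [complex.Re _]/=; ring.
Qed.

Lemma cauchy_schwarz (x y : H) : cnorm (dot x y) <= cnorm x * cnorm y.
Proof.
have [->|y0] := eqVneq y 0; first by rewrite linear0r cnorm0 mulr_ge0 ?cnorm_ge0.
have ny : 0 < cnorm y ^+ 2 by rewrite exprn_gt0// lt_def cnorm_eq0 y0 cnorm_ge0.
rewrite -(@ler_pXn2r _ 2) ?nnegrE ?mulr_ge0 ?cnorm_ge0// exprMn.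
have e : 2 * (cnorm y ^+ 2)^-1 - (cnorm y ^+ 2)^-1 ^+ 2 * cnorm y ^+ 2 =
    (cnorm y ^+ 2)^-1 by field; rewrite cnorm_eq0.
have := sqr_ge0 (cnorm (x - ((cnorm y ^+ 2)^-1%:C * dot x y) *: y)).
by rewrite cnorm_sqr_subZ e subr_ge0 ler_pdivrMr.
Qed.

Lemma dot_extl (x y : H) : (forall z, dot x z = dot y z) -> x = y.
Proof.
move=> h; apply/eqP; rewrite -subr_eq0 -cnorm_eq0 -sqrf_eq0.
by rewrite -(inj_eq (@complexI R)) -dotxx linearBl /= h subrr.
Qed.

Lemma dot_extr (x y : H) : (forall z, dot z x = dot z y) -> x = y.
Proof. by move=> h; apply: dot_extl => z; rewrite dotC h -dotC. Qed.

End InnerProduct.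

Section Completeness.
Context {R : realType} {H : completeNormedModType R[i]}.

(** Real epsilons and large inequalities keep the estimates in [R], where [lra] and [nra] apply; the
    topology of [H] takes its radii in R[i]. *)
Definition cnorm_cvg (u : nat -> H) (l : H) :=
  forall e : R, 0 < e -> exists N, forall n, (N <= n)%N -> cnorm (u n - l) <= e.

Lemma cnorm_cauchy_cvg (u : nat -> H) :
  (forall e : R, 0 < e -> exists N, forall m n, (N <= m)%N -> (N <= n)%N ->
     cnorm (u m - u n) <= e) -> exists l, cnorm_cvg u l.
Proof.
move=> uC; have : cauchy (u @ \oo).
  apply: cauchy_exP => e e0.
  have eE : e = (complex.Re e)%:C by rewrite RRe_real// gtr0_real.
  have e0' : 0 < complex.Re e / 2 by rewrite divr_gt0// -ltcR -eE.
  have [N hN] := uC _ e0'.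
  exists (u N); exists N => // n Nn; rewrite -ball_normE /= eE normE ltcR.
  by rewrite (le_lt_trans (hN N n _ _))//; lra.
move=> /cauchy_cvg /cvg_ex[l ul]; exists l => e e0.
have e0' : 0 < e%:C :> R[i] by rewrite ltcR.
have /cvgrPdist_le /(_ _ e0') [N _ hN] := ul.
by exists N => n Nn; have := hN n Nn; rewrite normE lecR cnorm_distC.
Qed.

Lemma le_eps (a b : R) : (forall e, 0 < e -> a <= b + e) -> a <= b.
Proof. by move=> h; apply/ler_addgt0Pr. Qed.

Lemma le_epsM (c a b : R) : 0 <= c -> (forall e, 0 < e -> a <= b + c * e) -> a <= b.
Proof.
move=> c0 h; apply: le_eps => e e0.
have c1 : 0 < c + 1 by rewrite ltr_wpDl.
apply: (le_trans (h (e / (c + 1)) (divr_gt0 e0 c1))); rewrite lerD2l mulrCA.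
by rewrite ler_piMr ?(ltW e0)// ler_pdivrMr// mul1r; lra.
Qed.

Lemma cnorm_eps0 (V : normedZmodType R[i]) (c : R) (x : V) :
  0 <= c -> (forall e, 0 < e -> cnorm x <= c * e) -> x = 0.
Proof.
move=> c0 h; apply/eqP; rewrite -cnorm_eq0 eq_le cnorm_ge0 andbT.
by apply: (le_epsM c0) => e e0; rewrite add0r h.
Qed.

End Completeness.

(** * Algebra of bounded and invertible operators *)

Section BoundedOperators.
Context {R : realType} {H : completeNormedModType R[i]}.
Implicit Types (S T X Y : H -> H).

Lemma bopD T : bounded_op T -> {morph T : x y / x + y}.
Proof. by case=> lT _ x y; have := lT 1 x y; rewrite !scale1r. Qed.

Lemma bop0 T : bounded_op T -> T 0 = 0.
Proof. by move=> bT; apply: (addrI (T 0)); rewrite -(bopD bT) !addr0. Qed.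

Lemma bopZ T : bounded_op T -> forall a, {morph T : x / a *: x}.
Proof.
by move=> bT a x; case: (bT) => /(_ a x 0) + _; rewrite (bop0 bT) !addr0.
Qed.

Lemma bopN T : bounded_op T -> {morph T : x / - x}.
Proof. by move=> bT x; rewrite -scaleN1r (bopZ bT) scaleN1r. Qed.

Lemma bopB T : bounded_op T -> {morph T : x y / x - y}.
Proof. by move=> bT x y; rewrite (bopD bT) (bopN bT). Qed.

Lemma bop_bound T : bounded_op T ->
  exists2 M : R, 0 < M & forall x, cnorm (T x) <= M * cnorm x.
Proof.
case=> _ [M hM]; exists (`|M| + 1) => [|x]; first by rewrite ltr_wpDl.
rewrite (le_trans (hM x))// ler_wpM2r ?cnorm_ge0//.
by rewrite (le_trans (ler_norm M))// lerDl.
Qed.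

Lemma bop_id : bounded_op (@idfun H).
Proof. by split=> //; exists 1 => x; rewrite mul1r. Qed.

Lemma bop_comp S T : bounded_op S -> bounded_op T -> bounded_op (S \o T).
Proof.
move=> bS bT; split=> [a x y /=|]; first by rewrite (bopD bT) (bopZ bT) (bopD bS) (bopZ bS).
have [M M0 hM] := bop_bound bS; have [N N0 hN] := bop_bound bT.
exists (M * N) => x /=; rewrite (le_trans (hM _))// -mulrA.
by rewrite ler_wpM2l ?hN// ltW.
Qed.

Lemma bop_add S T : bounded_op S -> bounded_op T ->
  bounded_op (fun x => S x + T x).
Proof.
move=> bS bT; split=> [a x y /=|].
  by rewrite (bopD bS) (bopD bT) (bopZ bS) (bopZ bT) scalerDr addrACA.
have [M M0 hM] := bop_bound bS; have [N N0 hN] := bop_bound bT.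
exists (M + N) => x /=; rewrite (le_trans (ler_cnormD _ _))// mulrDl.
by rewrite lerD ?hM ?hN.
Qed.

Lemma bop_scale T a : bounded_op T -> bounded_op (fun x => a *: T x).
Proof.
move=> bT; split=> [b x y /=|].
  by rewrite (bopD bT) (bopZ bT) scalerDr !scalerA mulrC.
have [M M0 hM] := bop_bound bT.
exists (cnorm a * M) => x /=; rewrite cnormZ -mulrA.
by rewrite ler_wpM2l ?cnorm_ge0// hM.
Qed.

Lemma bop_scalar (a : R[i]) : bounded_op (fun x : H => a *: x).
Proof. exact: bop_scale bop_id. Qed.

Lemma bop_opp T : bounded_op T -> bounded_op (fun x => - T x).
Proof.
move=> /(bop_scale (-1)); congr bounded_op.
by apply/funext => x; rewrite scaleN1r.
Qed.

Lemma bop_sub S T : bounded_op S -> bounded_op T ->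
  bounded_op (fun x => S x - T x).
Proof. by move=> bS /bop_opp; apply: bop_add. Qed.

Lemma bop_iter T n : bounded_op T -> bounded_op (iter n T).
Proof.
by move=> bT; elim: n => [|n IH]; [exact: bop_id|exact: (bop_comp bT IH)].
Qed.

Lemma bop_sum n (T : 'I_n -> H -> H) : (forall i, bounded_op (T i)) ->
  bounded_op (fun x => \sum_(i < n) T i x).
Proof.
elim: n T => [|n IH] T bT.
  split=> [a x y|]; first by rewrite !big_ord0 scaler0 addr0.
  by exists 0 => x; rewrite big_ord0 cnorm0 mul0r.
have := bop_add (IH (fun i => T (widen_ord (leqnSn n) i)) (fun i => bT _))
  (bT ord_max).
by congr bounded_op; apply/funext => x; rewrite big_ord_recr.
Qed.

(** The constant [c] gives injectivity and bounds the set-theoretic inverse by 1/c, so invertibility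
    reduces to an estimate and a surjectivity claim. *)
Lemma invertible_bijP X : invertible X <->
  [/\ bounded_op X, exists2 c : R, 0 < c & forall x, c * cnorm x <= cnorm (X x)
    & forall y, exists x, X x = y].
Proof.
split=> [[bX [Y [bY [XY YX]]]]|[bX [c c0 Xc] /choice[Y XY]]].
  split=> // [|y]; last by exists (Y y); rewrite -[X _]/((X \o Y) y) XY.
  have [M M0 hM] := bop_bound bY; exists M^-1 => [|x]; first by rewrite invr_gt0.
  by rewrite mulrC ler_pdivrMr// mulrC (le_trans _ (hM _))// -[Y _]/((Y \o X) x) YX.
have Xinj x y : X x = X y -> x = y.
  move=> xy; apply/eqP; rewrite -subr_eq0 -cnorm_eq0 eq_le cnorm_ge0 andbT.
  by rewrite -(ler_pM2l c0) mulr0 (le_trans (Xc _))// (bopB bX) xy subrr cnorm0.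
split=> //; exists Y; split; last first.
  by split; apply/funext => x /=; [|apply: Xinj]; rewrite XY.
split=> [a x y|]; first by apply: Xinj; rewrite XY (bopD bX) (bopZ bX) !XY.
exists c^-1 => x; rewrite mulrC ler_pdivlMr// mulrC (le_trans (Xc _))//.
by rewrite XY.
Qed.

Lemma invertible_op_inv X : invertible X -> is_inverse X (op_inv X).
Proof. by case=> _ XY; apply: xgetPex. Qed.

Lemma op_invK X x : invertible X -> op_inv X (X x) = x.
Proof.
by move=> /invertible_op_inv[_ [_ h]]; rewrite -[LHS]/((op_inv X \o X) x) h.
Qed.

Lemma op_invKV X x : invertible X -> X (op_inv X x) = x.
Proof.
by move=> /invertible_op_inv[_ [h _]]; rewrite -[LHS]/((X \o op_inv X) x) h.
Qed.

Lemma bop_inv X : invertible X -> bounded_op (op_inv X).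
Proof. by case/invertible_op_inv. Qed.

Lemma invertible_inv X : invertible X -> invertible (op_inv X).
Proof.
move=> iX; have [bY [XY YX]] := invertible_op_inv iX.
by split=> //; exists X; split; [case: iX|split].
Qed.

Lemma invertible_id : invertible (@idfun H).
Proof. by split; [exact: bop_id|exists idfun; split; [exact: bop_id|split]]. Qed.

Lemma invertible_comp X Y : invertible X -> invertible Y -> invertible (X \o Y).
Proof.
move=> [bX [X' [bX' [XX' X'X]]]] [bY [Y' [bY' [YY' Y'Y]]]].
split; first exact: bop_comp.
exists (Y' \o X'); split; first exact: bop_comp.
split; apply/funext => x /=.
  by rewrite -[Y (Y' _)]/((Y \o Y') _) YY' -[LHS]/((X \o X') _) XX'.
by rewrite -[X' (X _)]/((X' \o X) _) X'X -[LHS]/((Y' \o Y) _) Y'Y.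
Qed.

Lemma invertible_scale X (a : R[i]) : a != 0 -> invertible X ->
  invertible (fun x => a *: X x).
Proof.
move=> a0 [bX [Y [bY [XY YX]]]]; split; first exact: bop_scale.
exists (fun x => a^-1 *: Y x); split; first exact: bop_scale.
split; apply/funext => x /=; rewrite ?(bopZ bX) ?(bopZ bY) scalerA ?mulfV ?mulVf// scale1r.
  by rewrite -[LHS]/((X \o Y) _) XY.
by rewrite -[LHS]/((Y \o X) _) YX.
Qed.

Lemma opnorm_has_sup T : bounded_op T ->
  has_sup [set cnorm (T x) | x in [set x | cnorm x <= 1]].
Proof.
move=> bT; split; first by exists (cnorm (T 0)); exists 0; rewrite //= cnorm0.
have [M M0 hM] := bop_bound bT; exists M => _ [x /= x1 <-].
by rewrite (le_trans (hM x))// ler_piMr// ltW.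
Qed.

Lemma opnorm_ge0 T : bounded_op T -> 0 <= opnorm T.
Proof.
move=> bT; rewrite (le_trans (cnorm_ge0 (T 0)))// ub_le_sup//.
  by case: (opnorm_has_sup bT).
by exists 0 => //=; rewrite cnorm0.
Qed.

Lemma ler_opnorm T x : bounded_op T -> cnorm (T x) <= opnorm T * cnorm x.
Proof.
move=> bT; have [->|x0] := eqVneq x 0; first by rewrite (bop0 bT) !cnorm0 mulr0.
have n0 : 0 < cnorm x by rewrite lt_def cnorm_eq0 x0 cnorm_ge0.
rewrite -ler_pdivrMr//; apply: ub_le_sup; first by case: (opnorm_has_sup bT).
exists ((cnorm x)^-1%:C *: x) => /=.
  by rewrite cnormZ cnorm_real ger0_norm ?mulVf ?gt_eqF// invr_ge0 ltW.
by rewrite (bopZ bT) cnormZ cnorm_real ger0_norm ?invr_ge0 1?ltW// mulrC.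
Qed.

Lemma opnorm_le T (M : R) : 0 <= M -> (forall x, cnorm (T x) <= M * cnorm x) ->
  opnorm T <= M.
Proof.
move=> M0 hM; apply: ge_sup; first by exists (cnorm (T 0)); exists 0; rewrite //= cnorm0.
by move=> _ [x /= x1 <-]; rewrite (le_trans (hM x))// ler_piMr.
Qed.

End BoundedOperators.

(** * Projection, invertibility criteria, adjoints *)

Section HilbertSpace.
Context {R : realType} {H : completeNormedModType R[i]}.
Variable dot : {dot H for Num.conj}.
Hypothesis norm_dot : forall x : H, `|x| ^+ 2 = dot x x.
Implicit Types (A B S T X Y : H -> H).

Lemma natSinv_small (e : R) : 0 < e ->
  exists N, forall n, (N <= n)%N -> n.+1%:R^-1 <= e.
Proof.
move=> e0; have [N _ h] := near_infty_natSinv_lt (PosNum e0).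
by exists N => n Nn; apply/ltW/(h n).
Qed.

(* The distance from [x] to [M] is approached by a Cauchy sequence of [M]
   (parallelogram law), whose limit is the foot of the perpendicular. *)
Lemma orthogonal_projection (M : set H) : M 0 ->
  (forall a x y, M x -> M y -> M (a *: x + y)) ->
  forall x, exists p, (forall e : R, 0 < e -> exists2 y, M y & cnorm (p - y) <= e)
    /\ forall y, M y -> dot (x - p) y = 0.
Proof.
move=> M0 Mlin x; pose E := [set cnorm (x - y) ^+ 2 | y in M].
have lbE : has_lbound E by exists 0 => _ [y _ <-]; rewrite sqr_ge0.
have E0 : E !=set0 by exists (cnorm (x - 0) ^+ 2); exists 0.
pose d := inf E.
have dle y : M y -> d <= cnorm (x - y) ^+ 2 by move=> My; apply: ge_inf => //; exists y.
have /choice[u hu] : forall k : nat, exists y,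
    M y /\ cnorm (x - y) ^+ 2 <= d + k.+1%:R^-1.
  move=> k; have k0 : 0 < k.+1%:R^-1 :> R by rewrite invr_gt0.
  have [_ [y My <-] /ltW hy] := inf_adherent k0 (conj E0 lbE).
  by exists y.
have uC m n : cnorm (u m - u n) ^+ 2 <= 2 * (m.+1%:R^-1 + n.+1%:R^-1).
  have [Mm dm] := hu m; have [Mn dn] := hu n.
  have := parallelogram norm_dot (x - u n) (x - u m).
  have -> : x - u n - (x - u m) = u m - u n by rewrite opprB addrC addrA subrK.
  have Mmid : M (2^-1 *: (u n + u m)).
    rewrite -[_ *: _]addr0; apply: (Mlin) => //.
    by rewrite -[u n]scale1r; apply: Mlin.
  have -> : x - u n + (x - u m) = 2%:R *: (x - 2^-1 *: (u n + u m)).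
    rewrite scalerBr scalerA mulfV ?pnatr_eq0// scale1r scaler_nat mulr2n.
    by rewrite opprD addrACA.
  have := dle _ Mmid; rewrite cnormZ.
  have -> : cnorm (2%:R : R[i]) = 2.
    by rewrite -(rmorph_nat (real_complex R)) cnorm_real ger0_norm.
  rewrite exprMn; move: dm dn; move: (_^-1) (_^-1) => i j; nra.
have [|p up] := @cnorm_cauchy_cvg R H u.
  move=> e e0; have e4 : 0 < e ^+ 2 / 4 by rewrite divr_gt0 ?exprn_gt0.
  have [N hN] := natSinv_small e4; exists N => m n Nm Nn.
  rewrite -(@ler_pXn2r _ 2) ?nnegrE ?cnorm_ge0 ?(ltW e0)//.
  rewrite (le_trans (uC m n))//; have := hN m Nm; have := hN n Nn.
  by move: (m.+1%:R^-1) (n.+1%:R^-1) => i j; lra.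
exists p; split=> [e e0|y My].
  have [N /(_ N (leqnn N)) hN] := up e e0.
  by exists (u N); [case: (hu N)|rewrite cnorm_distC].
have [->|y0] := eqVneq y 0; first by rewrite linear0r.
have Y0 : 0 < cnorm y by rewrite lt_def cnorm_eq0 y0 cnorm_ge0.
(* Removing from x - u k its component along y amounts to moving u k within [M], so the squared
   distance cannot fall below [d], which [u k] exceeds by at most 1/(k+1). The gain |<x - u k, y>|^2
   / ||y||^2 is thus at most 1/(k+1). *)
have uy k : cnorm (dot (x - u k) y) ^+ 2 <= cnorm y ^+ 2 * k.+1%:R^-1.
  have [Mk dk] := hu k; set c := dot _ y.
  have : d <= cnorm (x - u k - ((cnorm y ^+ 2)^-1%:C * c) *: y) ^+ 2.
    by rewrite -addrA -opprD [u k + _]addrC; apply/dle/Mlin.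
  rewrite (cnorm_sqr_subZ norm_dot).
  have -> : 2 * (cnorm y ^+ 2)^-1 - (cnorm y ^+ 2)^-1 ^+ 2 * cnorm y ^+ 2 =
    (cnorm y ^+ 2)^-1 by field; rewrite cnorm_eq0.
  move=> h; rewrite [leRHS]mulrC -ler_pdivrMr ?exprn_gt0//; move: h dk.
  by move: (k.+1%:R^-1) (_ ^+ 2)^-1 => i j; lra.
apply: (@cnorm_eps0 _ _ (2 * cnorm y)) => [|e e0]; first by rewrite mulr_ge0 ?cnorm_ge0.
have [N1 hN1] := natSinv_small (exprn_gt0 2 e0); have [N2 hN2] := up e e0.
pose n := maxn N1 N2.
have -> : x - p = (x - u n) + (u n - p) by rewrite addrA subrK.
rewrite linearDl /= (le_trans (ler_cnormD _ _))// -mulrA mulr2n mulrDl !mul1r lerD//.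
  rewrite -(@ler_pXn2r _ 2) ?nnegrE ?mulr_ge0 ?cnorm_ge0 ?(ltW e0)//.
  rewrite exprMn (le_trans (uy n))// ler_wpM2l ?sqr_ge0// hN1 ?leq_maxl//.
rewrite (le_trans (cauchy_schwarz norm_dot _ _))// mulrC ler_wpM2l ?cnorm_ge0//.
by rewrite hN2 ?leq_maxr.
Qed.

(** The lower bound makes the range closed: if B (u k) converges, then [u] is Cauchy. The trivial
    orthogonal complement makes every y equal to its projection on the closure of the range. *)
Lemma invertible_dense_range B (c : R) : bounded_op B -> 0 < c ->
  (forall x, c * cnorm x <= cnorm (B x)) ->
  (forall y, (forall x, dot (B x) y = 0) -> y = 0) -> invertible B.
Proof.
move=> bB c0 Bc Bperp; apply/invertible_bijP; split=> [//||y]; first by exists c.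
have [||p [pB yp]] := @orthogonal_projection [set B x | x in setT] _ _ y.
- by exists 0; rewrite ?(bop0 bB).
- by move=> a _ _ [x _ <-] [z _ <-]; exists (a *: x + z); rewrite // (bopD bB) (bopZ bB).
have yE : y = p.
  apply/eqP; rewrite -subr_eq0; apply/eqP/Bperp => x.
  by rewrite dotC yp ?conjc0//; exists x.
have /choice[u hu] : forall k : nat, exists x, cnorm (p - B x) <= k.+1%:R^-1.
  move=> k; have k0 : 0 < k.+1%:R^-1 :> R by rewrite invr_gt0.
  by have [_ [x _ <-]] := pB _ k0; exists x.
have [|l ul] := @cnorm_cauchy_cvg R H u.
  move=> e e0; have ce : 0 < c * e / 2 by rewrite divr_gt0// mulr_gt0.
  have [N hN] := natSinv_small ce; exists N => m n Nm Nn.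
  rewrite -(ler_pM2l c0) (le_trans (Bc _))// (bopB bB).
  rewrite (le_trans (ler_cnorm_dist p _ _))// cnorm_distC.
  have := le_trans (hu m) (hN m Nm); have := le_trans (hu n) (hN n Nn); lra.
have [K K0 hK] := bop_bound bB.
exists l; apply/eqP; rewrite -subr_eq0; apply/eqP.
apply: (@cnorm_eps0 _ _ (K + 1)) => [|e e0]; first by rewrite addr_ge0// ltW.
have [N1 hN1] := natSinv_small e0; have [N2 hN2] := ul e e0.
pose n := maxn N1 N2; rewrite (le_trans (ler_cnorm_dist (B (u n)) _ _))// mulrDl lerD//.
  by rewrite cnorm_distC -(bopB bB) (le_trans (hK _))// ler_wpM2l ?(ltW K0)// hN2 ?leq_maxr.
by rewrite yE cnorm_distC mul1r (le_trans (hu n))// hN1 ?leq_maxl.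
Qed.

Lemma lax_milgram B (c : R) : bounded_op B -> 0 < c ->
  (forall x, c * cnorm x ^+ 2 <= cnorm (dot (B x) x)) -> invertible B.
Proof.
move=> bB c0 Bc; apply: (invertible_dense_range bB c0) => [x|y /(_ y) By].
  have [->|x0] := eqVneq x 0; first by rewrite cnorm0 mulr0 cnorm_ge0.
  have n0 : 0 < cnorm x by rewrite lt_def cnorm_eq0 x0 cnorm_ge0.
  by rewrite -(ler_pM2r n0) -mulrA (le_trans (Bc x))// cauchy_schwarz.
have := Bc y; rewrite By cnorm0 pmulr_rle0// => h.
by apply/eqP; rewrite -cnorm_eq0 -sqrf_eq0 eq_le h sqr_ge0.
Qed.

(** This replaces a Neumann series. B + E is bounded below by c - d, and a y = B x orthogonal to its
    range has ||y||^2 = - <E x, y> <= d ||x|| ||y||, which against c ||x|| <= ||y|| forces y = 0. *)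
Lemma invertible_perturb B E (c d : R) : invertible B -> bounded_op E ->
  (forall x, c * cnorm x <= cnorm (B x)) ->
  (forall x, cnorm (E x) <= d * cnorm x) -> 0 <= d < c ->
  invertible (fun x => B x + E x).
Proof.
move=> /invertible_bijP[bB _ Bsurj] bE Bc Ed /andP[d0 dc].
have cd : 0 < c - d by rewrite subr_gt0.
apply: (invertible_dense_range (bop_add bB bE) cd) => [x|y Ey].
  have := lerB_cnorm (B x) (- E x); rewrite opprK cnormN mulrBl.
  have := Bc x; have := Ed x; lra.
have [x xy] := Bsurj y; have := Ey x; rewrite linearDl /= xy dotxx// => h.
have {}h : cnorm y ^+ 2 <= cnorm y * (d * cnorm x).
  rewrite -[leLHS]ger0_norm ?sqr_ge0// -cnorm_real.
  have -> : (cnorm y ^+ 2)%:C = - dot (E x) y by apply/eqP; rewrite -addr_eq0 h.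
  rewrite cnormN (le_trans (cauchy_schwarz norm_dot _ _))// mulrC.
  by rewrite ler_wpM2l ?cnorm_ge0.
apply/eqP; apply: contraPT (h) => y0.
have n0 : 0 < cnorm y by rewrite lt_def cnorm_eq0 y0 cnorm_ge0.
rewrite expr2 ler_pM2l//; apply/negP; rewrite -ltNge.
have := Bc x; rewrite xy; apply: lt_le_trans.
rewrite ltr_pM2r// lt_def cnorm_ge0 andbT cnorm_eq0; apply: contra y0 => /eqP x0.
by rewrite -xy x0 (bop0 bB).
Qed.

(** Riesz representation of x |-> <T x, y>: if this functional is nonzero, subtracting from a vector
    outside its kernel the projection on the kernel leaves a normal [n], a multiple of which
    represents it. The bound on [S] follows from ||S y||^2 = <T (S y), y>. *)
Lemma adjoint_ex T : bounded_op T -> is_adjoint dot T !=set0.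
Proof.
move=> bT; have [K K0 hK] := bop_bound bT.
have /choice[S TS] : forall y, exists w, forall x, dot (T x) y = dot x w.
  move=> y; have [h|/existsNP[x0 /eqP Tx0]] := pselect (forall x, dot (T x) y = 0).
    by exists 0 => x; rewrite h linear0r.
  have [||p [pM x0p]] := @orthogonal_projection [set x | dot (T x) y = 0] _ _ x0.
  - by rewrite /= (bop0 bT) linear0l.
  - move=> a u v /= u0 v0.
    by rewrite (bopD bT) (bopZ bT) linearDl /= linearZl_LR /= u0 v0 mulr0 addr0.
  have Tp : dot (T p) y = 0.
    apply: (@cnorm_eps0 _ _ (K * cnorm y)) => [|e e0].
      by rewrite mulr_ge0 ?cnorm_ge0// ltW.
    have [m /= m0 pm] := pM e e0.
    have -> : dot (T p) y = dot (T (p - m)) y by rewrite (bopB bT) linearBl /= m0 subr0.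
    rewrite (le_trans (cauchy_schwarz norm_dot _ _))// mulrAC ler_wpM2r ?cnorm_ge0//.
    by rewrite (le_trans (hK _))// ler_wpM2l// ltW.
  pose n := x0 - p; pose f := dot (T n) y.
  have f0 : f != 0 by rewrite /f /n (bopB bT) linearBl /= Tp subr0.
  have n0 : cnorm n ^+ 2 != 0.
    rewrite sqrf_eq0 cnorm_eq0; apply: contra f0 => /eqP n0.
    by rewrite /f n0 (bop0 bT) linear0l.
  have nC : (cnorm n ^+ 2)%:C != 0 by rewrite (inj_eq (@complexI R) _ 0).
  exists (conjc (f / (cnorm n ^+ 2)%:C) *: n) => x.
  have : dot n (x - (dot (T x) y / f) *: n) = 0.
    apply: x0p => /=; rewrite (bopB bT) (bopZ bT) linearBl /= linearZl_LR /= -/f.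
    by rewrite mulfVK// subrr.
  move=> /(congr1 conjc); rewrite -dotC conjc0 linearBl /= linearZl_LR /= dotxx//.
  move=> /eqP; rewrite subr_eq0 => /eqP xn.
  rewrite dotZr conjcK xn; clearbody f; move: {xn} (dot (T x) y) (_%:C) nC => a N N0.
  by field; rewrite f0.
exists S; split; last by move=> x y; exact: TS.
split=> [a x y|].
  by apply: (dot_extr norm_dot) => z; rewrite -TS !linearDr /= !dotZr !TS.
exists K => y; have [->|Sy0] := eqVneq (S y) 0.
  by rewrite cnorm0 mulr_ge0 ?cnorm_ge0// ltW.
have n0 : 0 < cnorm (S y) by rewrite lt_def cnorm_eq0 Sy0 cnorm_ge0.
rewrite -(ler_pM2l n0) -expr2 -[leLHS]ger0_norm ?sqr_ge0// -cnorm_real -(dotxx norm_dot).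
rewrite -TS (le_trans (cauchy_schwarz norm_dot _ _))// mulrA [cnorm (S y) * _]mulrC.
by rewrite ler_wpM2r ?cnorm_ge0.
Qed.

Lemma bop_adjoint T : bounded_op T -> bounded_op (adjoint dot T).
Proof. by move=> /adjoint_ex /(xgetPex T)[]. Qed.

Lemma adjointP T x y : bounded_op T -> dot (T x) y = dot x (adjoint dot T y).
Proof. by move=> /adjoint_ex /(xgetPex T)[_]. Qed.

End HilbertSpace.

(** * Nonempty spectrum, attained spectral radius, contracting powers *)

Section Spectrum.
Context {R : realType} {H : completeNormedModType R[i]}.
Variable dot : {dot H for Num.conj}.
Hypothesis norm_dot : forall x : H, `|x| ^+ 2 = dot x x.
Implicit Types (E F S T X Y : H -> H).

Lemma bop_sub_scalar T (z : R[i]) : bounded_op T ->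
  bounded_op (fun x => T x - z *: x).
Proof. by move=> bT; apply: (bop_sub bT); apply: bop_scalar. Qed.

Lemma one_sub0 T : (fun x => x - 0 *: T x) = idfun.
Proof. by apply/funext => x; rewrite scale0r subr0. Qed.

Lemma invertible_one_sub T (z : R[i]) : ~ spectrum T z^-1 ->
  invertible (fun x => x - z *: T x).
Proof.
have [-> _|z0 /contrapT /(invertible_scale (a := - z))] := eqVneq z 0.
  by rewrite one_sub0; exact: invertible_id.
rewrite oppr_eq0 => /(_ z0); congr invertible; apply/funext => x /=.
by rewrite scalerBr scalerA mulNr mulfV// scaleN1r opprK scaleNr addrC.
Qed.

Lemma spectrum_le T (M : R) z : bounded_op T ->
  (forall x, cnorm (T x) <= M * cnorm x) -> 0 <= M -> spectrum T z -> cnorm z <= M.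
Proof.
move=> bT hM M0 /= sz; rewrite leNgt; apply/negP => Mz; apply: sz.
have z0 : z != 0 by rewrite -cnorm_eq0 gt_eqF// (le_lt_trans M0).
have iz : invertible (fun x : H => - z *: x).
  by rewrite -oppr_eq0 in z0; apply: (invertible_scale z0 invertible_id).
have -> : (fun x => T x - z *: x) = (fun x : H => - z *: x + T x : H).
  by apply/funext => x; rewrite scaleNr addrC.
apply: (@invertible_perturb _ _ _ norm_dot _ _ (cnorm z) M iz bT) => // [x|].
  by rewrite cnormZ cnormN.
by rewrite M0.
Qed.

(* Compactness of the disc, parametrized by polar coordinates. *)
Lemma resolvent_lower_bound T (tau : R) : bounded_op T ->
  (forall z, cnorm z <= tau -> invertible (fun x => x - z *: T x)) ->
  exists2 c : R, 0 < c &
    forall z x, cnorm z <= tau -> c * cnorm x <= cnorm (x - z *: T x).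
Proof.
move=> bT inv; have [K K0 hK] := bop_bound bT.
pose zz (p : R * R) : R[i] := p.1%:C * expi p.2.
have zzE p : zz p = (p.1 * cos p.2) +i* (p.1 * sin p.2).
  by rewrite /zz /expi; simpc.
pose P (c : R) (p : R * R) := forall x, c * cnorm x <= cnorm (x - zz p *: T x).
have cK := compact_setX (@segment_compact R 0 tau) (@segment_compact R (- pi) pi).
have zz_cont p0 (e : R) : 0 < e -> \forall p \near p0, cnorm (zz p0 - zz p) <= e.
  move=> e0; have e2 : 0 < e / 2 by rewrite divr_gt0.
  have c1 : p.1 * cos p.2 @[p --> p0] --> p0.1 * cos p0.2.
    apply: cvgM; first exact: cvg_fst.
    by apply: (continuous_cvg _ (@continuous_cos R _)); exact: cvg_snd.
  have c2 : p.1 * sin p.2 @[p --> p0] --> p0.1 * sin p0.2.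
    apply: cvgM; first exact: cvg_fst.
    by apply: (continuous_cvg _ (@continuous_sin R _)); exact: cvg_snd.
  move/cvgrPdist_le : c1 => /(_ _ e2) n1; move/cvgrPdist_le : c2 => /(_ _ e2) n2.
  apply: filterS2 n1 n2 => p h1 h2; rewrite !zzE.
  set a := _ * cos p0.2 in h1 *; set b := _ * cos _ in h1 *.
  set a' := _ * sin p0.2 in h2 *; set b' := _ * sin _ in h2 *.
  rewrite (_ : _ - _ = (a - b)%:C + (a' - b')%:C * 'i); last by simpc.
  rewrite (le_trans (ler_cnormD _ _))// cnormM !cnorm_real.
  rewrite (_ : cnorm 'i = 1) ?mulr1; last by rewrite /cnorm normc_def /= expr0n expr1n add0r sqrtr1.
  by rewrite [e]splitr lerD.
have cov : \forall c \near 0^'+, `[0, tau] `*` `[- pi, pi] `<=` P c.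
  apply: (iffLR (compact_near_coveringP _) cK) => -[s t] [/= s01 tpi].
  have zst : cnorm (zz (s, t)) <= tau.
    move: s01; rewrite in_itv /= => /andP[s0 s1].
    by rewrite cnormM cnorm_expi mulr1 cnorm_real ger0_norm.
  have /invertible_bijP[_ [c c0 hc] _] := inv _ zst.
  (* Half of the local constant [c] pays for moving z by at most c / (2 K), which changes z T x by
     at most (c / 2) ||x||; every d <= c / 2 then remains valid nearby. *)
  have cK2 : 0 < c / 2 / K by rewrite !divr_gt0.
  exists ([set p | cnorm (zz (s, t) - zz p) <= c / 2 / K], [set d | d <= c / 2]) => /=.
    split; first exact: zz_cont.
    by apply: nbhs_right_le; rewrite divr_gt0.
  move=> [p d] [/= hp hd] x.
  have -> : x - zz p *: T x = x - zz (s, t) *: T x - (zz p - zz (s, t)) *: T x.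
    by rewrite scalerBl opprB addrA subrK.
  rewrite (le_trans _ (lerB_cnorm _ _))// cnormZ (cnorm_distC (zz p)).
  have h1 := hc x.
  have h2 : cnorm (zz (s, t) - zz p) * cnorm (T x) <= c / 2 * cnorm x.
    rewrite (le_trans (ler_pM _ _ hp (hK x))) ?cnorm_ge0//.
    by rewrite mulrA divfK ?gt_eqF.
  have h3 : d * cnorm x <= c / 2 * cnorm x by rewrite ler_wpM2r ?cnorm_ge0.
  lra.
have [c [c0 hc]] := filter_ex (filterI (nbhs_right_gt 0) cov).
exists c => // z x ztau; have [t tpi ->] := polar_form z.
by apply: (hc (cnorm z, t)); split; rewrite /= in_itv /= ?cnorm_ge0.
Qed.

Lemma iter_double T k : iter (2 ^ k.+1) T = iter (2 ^ k) T \o iter (2 ^ k) T.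
Proof. by apply/funext => x; rewrite expnS mul2n -addnn iterD. Qed.

(* The resolvent [(1 - mu E^2)^-1] is the average of [(1 - nu E)^-1] and
   [(1 + nu E)^-1] with [nu^2 = mu], so closeness of the resolvents of [E] and
   [F] along the unit circle passes to the squares. *)
Lemma resolvent_close_sqr E F (eta : R) : bounded_op E -> bounded_op F ->
  (forall mu : R[i], cnorm mu = 1 -> forall x, exists2 a,
    a - mu *: E a = x - mu *: F x &
    cnorm (a - x) <= eta * cnorm (x - mu *: F x)) ->
  forall mu : R[i], cnorm mu = 1 -> forall x, exists2 a,
    a - mu *: (E \o E) a = x - mu *: (F \o F) x &
    cnorm (a - x) <= eta * cnorm (x - mu *: (F \o F) x).
Proof.
move=> bE bF close mu mu1 x; pose nu := sqrtc mu.
have nu2 : nu * nu = mu by rewrite -expr2 sqr_sqrtc.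
have nu1 : cnorm nu = 1.
  by apply/eqP; rewrite -(@eqrXn2 _ 2) ?cnorm_ge0// expr1n expr2 -cnormM nu2 mu1.
pose y := x - mu *: F (F x).
(* Since (1 - nu F)(x + nu F x) = y = (1 + nu F)(x - nu F x), these two arguments are the resolvents
   of [F] applied to [y]; [a] and [b] are those of [E] at the same [y]. *)
have [a aE ax] := close nu nu1 (x + nu *: F x).
have nu1' : cnorm (- nu) = 1 by rewrite cnormN.
have [b bE' bx] := close (- nu) nu1' (x - nu *: F x).
have yE1 : x + nu *: F x - nu *: F (x + nu *: F x) = y.
  by rewrite (bopD bF) (bopZ bF) scalerDr scalerA nu2 opprD addrA addrK.
have yE2 : x - nu *: F x - - nu *: F (x - nu *: F x) = y.
  rewrite (bopB bF) (bopZ bF) scaleNr opprK scalerBr scalerA nu2.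
  by rewrite addrA subrK.
rewrite yE1 in aE ax; rewrite yE2 scaleNr opprK in bE'; rewrite yE2 in bx.
have {}aE : a = y + nu *: E a by rewrite -aE subrK.
have {}bE' : b = y - nu *: E b by rewrite -bE' addrK.
have aE2 : a = y + nu *: E y + mu *: E (E a).
  by rewrite {1}aE {1}aE (bopD bE) (bopZ bE) scalerDr scalerA nu2 addrA.
have bE2 : b = y - nu *: E y + mu *: E (E b).
  by rewrite {1}bE' {1}bE' (bopB bE) (bopZ bE) scalerBr scalerA nu2 opprB addrA addrAC.
exists (2^-1 *: (a + b)) => /=.
  rewrite !(bopZ bE) !(bopD bE) scalerA [mu * _]mulrC -scalerA -scalerBr.
  have -> : a + b - mu *: (E (E a) + E (E b)) = y + y.
    rewrite {1}aE2 {1}bE2 scalerDr [X in X - _]addrACA addrK.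
    by rewrite addrACA subrr addr0.
  by rewrite -[y + y]mulr2n -[y *+ 2]scaler_nat scalerA mulVf ?pnatr_eq0// scale1r.
have -> : 2^-1 *: (a + b) - x =
    2^-1 *: ((a - (x + nu *: F x)) + (b - (x - nu *: F x))).
  rewrite addrACA -opprD addrACA subrr addr0 scalerBr -[x + x]mulr2n -[x *+ 2]scaler_nat.
  by rewrite scalerA mulVf ?pnatr_eq0// scale1r.
rewrite cnormZ (_ : cnorm 2^-1 = 2^-1); last first.
  by rewrite cnormV -(rmorph_nat (real_complex R)) cnorm_real ger0_norm.
by have := ler_cnormD (a - (x + nu *: F x)) (b - (x - nu *: F x)); lra.
Qed.

(** By the resolvent identity the resolvents of s T and t T along the unit circle differ by at most
    (t - s) K / c^2 <= 1/8, and [resolvent_close_sqr] carries this 1/8 to all powers 2^j without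
    loss. At j = k the power of s T is small, so its resolvent is near the identity; hence so is
    that of t T, whose power must be small too. *)
Lemma contraction_step T (s t tau c K : R) : bounded_op T -> 0 < c ->
  (forall x, cnorm (T x) <= K * cnorm x) ->
  (forall z, cnorm z <= tau -> invertible (fun x => x - z *: T x)) ->
  (forall z x, cnorm z <= tau -> c * cnorm x <= cnorm (x - z *: T x)) ->
  0 <= s -> s <= t -> t <= tau -> (t - s) * K <= c ^+ 2 / 8 ->
  (exists k, forall x,
    cnorm (iter (2 ^ k) (fun x => s%:C *: T x) x) <= 8^-1 * cnorm x) ->
  exists k, forall x,
    cnorm (iter (2 ^ k) (fun x => t%:C *: T x) x) <= 8^-1 * cnorm x.
Proof.
move=> bT c0 hK inv hc s0 st ttau ts [k hk].
set E := fun x => s%:C *: T x in hk *; set F := fun x => t%:C *: T x.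
have bE : bounded_op E by exact: bop_scale.
have bF : bounded_op F by exact: bop_scale.
have close j : forall mu : R[i], cnorm mu = 1 -> forall x, exists2 a,
    a - mu *: iter (2 ^ j) E a = x - mu *: iter (2 ^ j) F x &
    cnorm (a - x) <= 8^-1 * cnorm (x - mu *: iter (2 ^ j) F x).
  elim: j => [|j IH]; last first.
    by rewrite !iter_double; apply: resolvent_close_sqr => //; exact: bop_iter.
  move=> mu mu1 x /=; rewrite /E /F; set y := x - _.
  have mus : cnorm (mu * s%:C) <= tau.
    by rewrite cnormM mu1 mul1r cnorm_real ger0_norm// (le_trans st).
  have mut : cnorm (mu * t%:C) <= tau.
    by rewrite cnormM mu1 mul1r cnorm_real ger0_norm// (le_trans s0).
  have /invertible_bijP[_ _ /(_ y)[a ay]] := inv _ mus.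
  exists a; first by rewrite scalerA.
  have h1 := hc _ (a - x) mus; have h2 := hc _ x mut.
  have e1 : a - x - mu * s%:C *: T (a - x) = (mu * (s - t)%:C) *: T x.
    rewrite (bopB bT) scalerBr opprB addrACA [- x - _]addrC addrACA ay.
    by rewrite /y addrC addrA subrK scalerA -scalerBl -mulrBr -rmorphB.
  have {}h2 : c * cnorm x <= cnorm y by rewrite /y scalerA.
  have {}h1 : c * cnorm (a - x) <= c ^+ 2 / 8 * cnorm x.
    rewrite (le_trans h1)// e1 cnormZ cnormM mu1 mul1r cnorm_real distrC.
    rewrite ger0_norm ?subr_ge0// (le_trans (ler_wpM2l _ (hK x))) ?subr_ge0//.
    by rewrite mulrA ler_wpM2r ?cnorm_ge0.
  rewrite -(ler_pM2l c0) (le_trans h1)// expr2 -!mulrA ler_pM2l// mulrCA.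
  by rewrite ler_pM2l ?invr_gt0.
(* Here ||f|| <= ||x - a|| + ||a|| / 8 and ||x - a|| <= (||x|| + ||f||) / 8 give ||f|| <= (17/55)
   ||x||. Two more squarings then turn 1/2 into 1/16, restoring the 1/8 of the hypothesis. *)
have Fk x : cnorm (iter (2 ^ k) F x) <= 2^-1 * cnorm x.
  have [a ae ax] := close k 1 cnorm1 x; rewrite !scale1r in ae ax.
  set f := iter (2 ^ k) F x in ae ax *; set e := iter (2 ^ k) E a in ae.
  have fE : f = (x - a) + e.
    have <- : x - (a - e) = f by rewrite ae opprB addrC subrK.
    by rewrite opprB addrA addrAC.
  have h1 := hk a; rewrite -/e in h1.
  have h2 := ler_cnormD (x - a) e; rewrite -fE cnorm_distC in h2.
  have h3 := ler_cnormD x (a - x); rewrite addrC subrK in h3.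
  have h4 := ler_cnormB x f; have h5 := cnorm_ge0 x.
  lra.
exists k.+2 => x; rewrite !iter_double /=.
have := Fk x; have := Fk (iter (2 ^ k) F x).
set u := iter _ F (iter _ F x); have := Fk u; have := Fk (iter (2 ^ k) F u).
have := cnorm_ge0 x; lra.
Qed.

(** The constant [c] is uniform over the disc, so steps of a fixed length suffice, and finitely many
    lead from 0, where the operator vanishes, to [tau]. *)
Lemma contraction_power T (tau : R) : bounded_op T -> 0 <= tau ->
  (forall z, cnorm z <= tau -> invertible (fun x => x - z *: T x)) ->
  exists k, forall x,
    cnorm (iter (2 ^ k) (fun x => tau%:C *: T x) x) <= 8^-1 * cnorm x.
Proof.
move=> bT tau0 inv; have [K K0 hK] := bop_bound bT.
have [c c0 hc] := resolvent_lower_bound bT inv.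
have e0 : 0 < c ^+ 2 / 8 / (tau * K + 1).
  by rewrite !divr_gt0 ?exprn_gt0// ltr_wpDl// mulr_ge0// ltW.
have [N /(_ N (leqnn N)) hN] := natSinv_small e0.
pose s j : R := tau * (j%:R / N.+1%:R).
have sN : s N.+1 = tau by rewrite /s divff ?mulr1// pnatr_eq0.
suff step j : (j <= N.+1)%N -> exists k, forall x,
    cnorm (iter (2 ^ k) (fun x => (s j)%:C *: T x) x) <= 8^-1 * cnorm x.
  by have := step N.+1 (leqnn _); rewrite sN.
elim: j => [_|j IH jN].
  exists 0%N => x; rewrite expn0 /= /s mul0r mulr0 scale0r cnorm0.
  by rewrite mulr_ge0 ?cnorm_ge0.
apply: (@contraction_step _ (s j) _ tau c K) (IH (ltnW jN)) => //.
- by rewrite !mulr_ge0 ?invr_ge0.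
- by rewrite ler_wpM2l// ler_wpM2r ?invr_ge0// ler_nat.
- by rewrite ler_piMr// ler_pdivrMr ?ltr0n// mul1r ler_nat.
- rewrite -mulrBr -mulrBl -natrB// subSnn mul1r mulrAC.
  have tK : 0 < tau * K + 1 by rewrite ltr_wpDl// mulr_ge0// ltW.
  have := hN; rewrite ler_pdivlMr// => hN'.
  rewrite (le_trans _ hN')// mulrC ler_wpM2l ?invr_ge0//; lra.
Qed.

(** With an empty spectrum T itself is invertible, hence bounded below by some c > 0, and no power
    of T / c shrinks a norm. But [contraction_power] then applies at every radius, in particular
    1/c. *)
Lemma spectrum_neq0 T : (exists x : H, x != 0) -> bounded_op T -> spectrum T !=set0.
Proof.
move=> [v v0] bT; apply: contrapT => /nonemptyPn sT0.
have sT z : ~ spectrum T z by rewrite sT0.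
have /contrapT := sT 0.
have -> : (fun x => T x - 0 *: x) = T by apply/funext => x; rewrite scale0r subr0.
case/invertible_bijP=> _ [c c0 hc] _.
have ci : 0 <= c^-1 by rewrite invr_ge0 ltW.
have [z _|k /(_ v)] := contraction_power bT ci; first exact: invertible_one_sub.
have low n : cnorm v <= cnorm (iter n (fun x => c^-1%:C *: T x) v).
  elim: n => // n IH; rewrite iterS cnormZ cnorm_real ger0_norm// mulrC.
  by rewrite ler_pdivlMr// mulrC (le_trans _ (hc _))// ler_pM2l.
have n0 : 0 < cnorm v by rewrite lt_def cnorm_eq0 v0 cnorm_ge0.
have := low (2 ^ k)%N; lra.
Qed.

Lemma spectrum_has_sup T : (exists x : H, x != 0) -> bounded_op T ->
  has_sup [set cnorm z | z in spectrum T].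
Proof.
move=> H0 bT; split; first by have [z sz] := spectrum_neq0 H0 bT; exists (cnorm z); exists z.
have [K K0 hK] := bop_bound bT; exists K => _ [z sz <-].
exact: spectrum_le hK (ltW K0) sz.
Qed.

Lemma spectral_radius_ub T z : (exists x : H, x != 0) -> bounded_op T ->
  spectrum T z -> cnorm z <= spectral_radius T.
Proof.
move=> H0 bT sz; apply: ub_le_sup; last by exists z.
by case: (spectrum_has_sup H0 bT).
Qed.

Lemma spectral_radius_ge0 T : (exists x : H, x != 0) -> bounded_op T ->
  0 <= spectral_radius T.
Proof.
move=> H0 bT; have [z sz] := spectrum_neq0 H0 bT.
exact: le_trans (cnorm_ge0 z) (spectral_radius_ub H0 bT sz).
Qed.

(** Otherwise 1 - z T is bounded below by a common [c] on |z| <= 1/r. Push a spectral value [w] with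
    |w| > r - r c radially to [w'] of modulus [r]: T - w' is bounded below by r c, and T - w differs
    from it by r - |w| < r c, so it is invertible. *)
Lemma spectral_radius_attained T : (exists x : H, x != 0) -> bounded_op T ->
  exists2 z, spectrum T z & cnorm z = spectral_radius T.
Proof.
move=> H0 bT; set r := spectral_radius T; apply: contrapT => nz.
have sr z : spectrum T z -> cnorm z < r.
  move=> sz; rewrite lt_neqAle (spectral_radius_ub H0 bT sz) andbT.
  by apply/eqP => zr; apply: nz; exists z.
have r0 : 0 < r.
  have [z /sr] := spectrum_neq0 H0 bT; exact/le_lt_trans/cnorm_ge0.
have inv z : cnorm z <= r^-1 -> invertible (fun x => x - z *: T x).
  have [-> _|z0 zr] := eqVneq z 0.
    by rewrite one_sub0; exact: invertible_id.
  apply: invertible_one_sub => /sr; rewrite cnormV.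
  have zp : 0 < cnorm z by rewrite lt_def cnorm_eq0 z0 cnorm_ge0.
  by rewrite invf_plt ?posrE// ltNge zr.
have [c c0 hc] := resolvent_lower_bound bT inv.
have rc : 0 < r * c by rewrite mulr_gt0.
have [_ [w sw <-]] := sup_adherent rc (spectrum_has_sup H0 bT).
rewrite -/(spectral_radius T) -/r => wr; have wr' := sr _ sw.
have [t _ wE] := polar_form w; apply: sw => /=.
pose w' := r%:C * expi t.
have w'r : cnorm w' = r by rewrite cnormM cnorm_expi mulr1 cnorm_real gtr0_norm.
have w'0 : w' != 0 by rewrite -cnorm_eq0 w'r gt_eqF.
have iw' : invertible (fun x => T x - w' *: x).
  by apply: contrapT => /sr; rewrite w'r ltxx.
have -> : (fun x => T x - w *: x) =
    (fun x : H => (T x - w' *: x) + (w' - w) *: x : H).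
  by apply/funext => x; rewrite scalerBl addrA subrK.
apply: (@invertible_perturb _ _ _ norm_dot _ _ (r * c) (r - cnorm w) iw'
  (bop_scalar _)) => [x|x|].
- have -> : T x - w' *: x = - w' *: (x - w'^-1 *: T x).
    by rewrite scalerBr scalerA mulNr mulfV// scaleN1r scaleNr opprK addrC.
  rewrite cnormZ cnormN w'r -mulrA ler_pM2l// hc// cnormV w'r//.
- rewrite cnormZ {1}wE /w' -mulrBl cnormM cnorm_expi mulr1 -rmorphB cnorm_real.
  by rewrite ger0_norm// subr_ge0 ltW.
- by rewrite subr_ge0 (ltW wr')/=; lra.
Qed.

End Spectrum.

(** * Uniform polynomial approximation of t^s *)

Section PowerApproximation.
Context {R : realType}.
Implicit Types (x y s t e : R) (g h : nat -> R).

(** For 0 <= u <= x one has u / x <= (u / x)^s; adding the cases u = y and u = x - y gives x^s <=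
    y^s + (x - y)^s. *)
Lemma powR_subadd s x y : 0 <= s <= 1 -> 0 <= y -> y <= x ->
  `|x `^ s - y `^ s| <= (x - y) `^ s.
Proof.
move=> /andP[s0 s1] y0 yx; have x0 : 0 <= x := le_trans y0 yx.
rewrite ger0_norm ?subr_ge0 ?ge0_ler_powR ?nnegrE//.
have [xz|xn0] := eqVneq x 0.
  have yz : y = 0 by lra.
  by rewrite xz yz !subrr powR_ge0.
have xp : 0 < x by rewrite lt_def xn0.
have frac u : 0 <= u -> u <= x -> u / x * x `^ s <= u `^ s.
  move=> u0 ux; rewrite -{2}(divfK xn0 u) powRM ?divr_ge0//.
  rewrite ler_wpM2r ?powR_ge0//; have [->|un0] := eqVneq u 0.
    by rewrite mul0r powR_ge0.
  have up : 0 < u by rewrite lt_def un0.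
  by rewrite ger1_powR// divr_gt0//= ler_pdivrMr// mul1r.
have := frac y y0 yx; have := frac (x - y) _ _.
rewrite subr_ge0 yx => /(_ isT); rewrite lerBlDr lerDl y0 => /(_ isT).
rewrite mulrBl divff// mulrBl mul1r; lra.
Qed.

(** The error term is quadratic because Bernstein polynomials have an explicit second moment. For s
    > 0 and d = e^(1/s), an increment h <= d costs at most d^s = e, a larger one e (h / d)^s <= e (h
    / d)^2. *)
Lemma powR_modulus s e : 0 <= s <= 1 -> 0 < e -> exists2 C, 0 <= C &
  forall x y, 0 <= x -> 0 <= y -> `|x `^ s - y `^ s| <= e + C * (x - y) ^+ 2.
Proof.
move=> s01 e0; have /andP[s0 s1] := s01.
have [->|sn0] := eqVneq s 0.
  by exists 0 => // x y _ _; rewrite !powRr0 subrr normr0 mul0r addr0 ltW.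
pose d := e `^ s^-1; have d0 : 0 < d by rewrite powR_gt0.
have ds : d `^ s = e by rewrite /d -powRrM mulVf// powRr1// ltW.
have C0 : 0 <= e / d ^+ 2 by rewrite divr_ge0 ?sqr_ge0 ?ltW.
have key (h : R) : 0 <= h -> h `^ s <= e + e / d ^+ 2 * h ^+ 2.
  move=> h0; have [hd|/ltW dh] := leP h d.
    have hds : h `^ s <= d `^ s by apply: ge0_ler_powR; rewrite ?nnegrE// ltW.
    by rewrite (le_trans hds)// ds lerDl mulr_ge0// sqr_ge0.
  rewrite -[h in leLHS](divfK (lt0r_neq0 d0)) powRM ?divr_ge0 ?(ltW d0)// ds.
  have h1 : 1 <= h / d by rewrite ler_pdivlMr// mul1r.
  have s2 : s <= 2%:R by rewrite (le_trans s1)// ler1n.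
  have := ler_powR h1 s2; rewrite powR_mulrn ?divr_ge0 ?(ltW d0)// => hs.
  rewrite (le_trans (ler_wpM2r (ltW e0) hs))// expr_div_n.
  rewrite (_ : _ * e = e / d ^+ 2 * h ^+ 2) ?lerDr ?ltW//; ring.
exists (e / d ^+ 2) => // x y x0 y0.
wlog yx : x y x0 y0 / y <= x => [hw|].
  have [yx|/ltW xy] := leP y x; first exact: hw.
  by rewrite distrC -[(x - y) ^+ 2]sqrrN opprB hw.
by rewrite (le_trans (powR_subadd s01 y0 yx))// key// subr_ge0.
Qed.

(* [bernstein n g] is the Bernstein polynomial
   [\sum_k C(n, k) g(k) X^k (1 - X)^(n - k)]. *)
Fixpoint bernstein n g : {poly R} :=
  if n is m.+1 then
    (1 - 'X) * bernstein m g + 'X * bernstein m (fun k => g k.+1)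
  else (g 0%N)%:P.

Lemma bernsteinS n g x : (bernstein n.+1 g).[x] =
  (1 - x) * (bernstein n g).[x] + x * (bernstein n (fun k => g k.+1)).[x].
Proof. by rewrite /= !hornerE. Qed.

Lemma bernstein_lin n g h (a b c : R) x :
  (bernstein n (fun k => a * g k + b * h k + c)).[x] =
  a * (bernstein n g).[x] + b * (bernstein n h).[x] + c.
Proof.
elim: n g h => [|n IH] g h; first by rewrite /= !hornerE.
by rewrite !bernsteinS !IH; ring.
Qed.

Lemma bernstein_le n g h x : 0 <= x <= 1 -> (forall k, `|g k| <= h k) ->
  `|(bernstein n g).[x]| <= (bernstein n h).[x].
Proof.
move=> /andP[x0 x1]; elim: n g h => [|n IH] g h gh; first by rewrite /= !hornerC.
have x1' : 0 <= 1 - x by rewrite subr_ge0.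
rewrite !bernsteinS (le_trans (ler_normD _ _))// !normrM.
by rewrite (ger0_norm x0) (ger0_norm x1') lerD// ler_wpM2l// IH.
Qed.

(** Squared bias plus variance of a binomial variable with parameters n and x. The centre [a] is
    arbitrary because the recursion replaces it by a - 1. *)
Lemma bernstein_sqr n (a x : R) :
  (bernstein n (fun k => (k%:R - a) ^+ 2)).[x] =
  (n%:R * x - a) ^+ 2 + n%:R * (x * (1 - x)).
Proof.
elim: n a => [|n IH] a; first by rewrite /= hornerC; ring.
rewrite bernsteinS IH.
have -> : (fun k : nat => (k.+1%:R - a) ^+ 2) =
    (fun k : nat => (k%:R - (a - 1)) ^+ 2).
  by apply/funext => k; rewrite -natr1; congr (_ ^+ 2); ring.
by rewrite IH -natr1; ring.
Qed.

(** The pointwise bound is averaged with the Bernstein weights: for N = n + 1 and centre a = N x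
    only the variance N x (1 - x) <= N remains, and C / N^2 turns it into C / N. *)
Lemma bernstein_cvg (f : R -> R) (e C : R) n x : 0 <= x <= 1 -> 0 <= C ->
  (forall k : nat, `|f (k%:R / n.+1%:R) - f x| <=
     e + C * (k%:R / n.+1%:R - x) ^+ 2) ->
  `|(bernstein n.+1 (fun k => f (k%:R / n.+1%:R))).[x] - f x| <= e + C / n.+1%:R.
Proof.
move=> x01 C0 fC; pose N : R := n.+1%:R; have N0 : 0 < N by rewrite ltr0n.
have := @bernstein_le n.+1 _ _ _ x01 fC.
have -> : (fun k : nat => f (k%:R / N) - f x) =
    (fun k : nat => 1 * f (k%:R / N) + 0 * 0 + - f x).
  by apply/funext => k; ring.
rewrite bernstein_lin mul1r mul0r addr0 => /le_trans; apply.
have -> : (fun k : nat => e + C * (k%:R / N - x) ^+ 2) =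
    (fun k : nat => C / N ^+ 2 * (k%:R - N * x) ^+ 2 + 0 * 0 + e).
  by apply/funext => k; field; rewrite gt_eqF.
rewrite bernstein_lin bernstein_sqr -/N subrr expr0n add0r mul0r addr0 addrC lerD2l.
have -> : C / N ^+ 2 * (N * (x * (1 - x))) = C / N * (x * (1 - x)).
  by field; rewrite gt_eqF.
rewrite ler_piMr ?divr_ge0 ?(ltW N0)//; nra.
Qed.

Lemma powR_poly_approx s (M e : R) : 0 <= s <= 1 -> 0 < M -> 0 < e ->
  exists p : {poly R}, forall t, 0 <= t <= M -> `|p.[t] - t `^ s| <= e.
Proof.
move=> s01 M0 e0; have e2 : 0 < e / 2 by rewrite divr_gt0.
have [C C0 hC] := powR_modulus s01 e2.
have CM : 0 <= C * M ^+ 2 by rewrite mulr_ge0 ?sqr_ge0.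
have ec : 0 < e / 2 / (C * M ^+ 2 + 1) by rewrite divr_gt0// ltr_wpDl.
have [n /(_ n (leqnn n)) hn] := natSinv_small ec.
pose f u := (M * u) `^ s.
exists (bernstein n.+1 (fun k => f (k%:R / n.+1%:R)) \Po (M^-1 *: 'X)) => t /andP[t0 tM].
rewrite horner_comp hornerZ hornerX.
have tE : t = M * (M^-1 * t) by rewrite mulrA mulfV ?mul1r// gt_eqF.
have x01 : 0 <= M^-1 * t <= 1.
  by rewrite mulr_ge0 ?invr_ge0 ?(ltW M0)//= mulrC ler_pdivrMr// mul1r.
rewrite [t in X in _ - X]tE -/(f (M^-1 * t)).
rewrite (le_trans (@bernstein_cvg f (e / 2) _ n _ x01 CM _))//.
  move=> k; have h1 : 0 <= M * (k%:R / n.+1%:R).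
    by rewrite mulr_ge0 ?divr_ge0 ?(ltW M0).
  have h2 : 0 <= M * (M^-1 * t) by rewrite -tE.
  by rewrite -[C * M ^+ 2 * _]mulrA -exprMn mulrBr; exact: hC.
have c1 : 0 < C * M ^+ 2 + 1 by rewrite ltr_wpDl.
rewrite [leRHS]splitr lerD2l; move: hn; rewrite ler_pdivlMr//.
apply: le_trans; rewrite mulrC ler_wpM2l ?invr_ge0//; lra.
Qed.

End PowerApproximation.

(** * Polynomials of an operator *)

Section Polynomials.
Context {R : realType} {H : completeNormedModType R[i]}.
Implicit Types (A B : H -> H) (p q : {poly R}) (P Q : {poly R[i]}).

(** Complex coefficients allow the splitting into linear factors in [cpoly_op_invertible]. *)
Definition cpoly_op P A : H -> H := fun x => \sum_(i < size P) P`_i *: iter i A x.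

Lemma poly_opE p A : poly_op p A = cpoly_op (map_poly (real_complex R) p) A.
Proof.
apply/funext => x; rewrite /poly_op /cpoly_op size_map_poly.
by apply: eq_bigr => i _; rewrite coef_map.
Qed.

Lemma cpoly_op_widen n P A x : (size P <= n)%N ->
  cpoly_op P A x = \sum_(i < n) P`_i *: iter i A x.
Proof.
move=> Pn; rewrite /cpoly_op (big_ord_widen _ (fun i => P`_i *: iter i A x) Pn).
rewrite big_mkcond; apply: eq_bigr => i _; case: ltnP => // Pi.
by rewrite nth_default// scale0r.
Qed.

Lemma cpoly_opD P Q A x : cpoly_op (P + Q) A x = cpoly_op P A x + cpoly_op Q A x.
Proof.
pose n := maxn (size P) (size Q).
rewrite (@cpoly_op_widen n) ?size_polyD// (@cpoly_op_widen n P) ?leq_maxl//.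
rewrite (@cpoly_op_widen n Q) ?leq_maxr// -big_split.
by apply: eq_bigr => i _; rewrite coefD scalerDl.
Qed.

Lemma cpoly_opZ a P A x : cpoly_op (a *: P) A x = a *: cpoly_op P A x.
Proof.
rewrite (@cpoly_op_widen (size P)) ?size_scale_leq// scaler_sumr.
by apply: eq_bigr => i _; rewrite coefZ scalerA.
Qed.

Lemma cpoly_opC a A x : cpoly_op a%:P A x = a *: x.
Proof.
by rewrite (@cpoly_op_widen 1%N) ?size_polyC_leq1// big_ord1 coefC.
Qed.

Lemma cpoly_op0 A x : cpoly_op 0 A x = 0.
Proof. by rewrite -[0 in LHS]/(0%:P) cpoly_opC scale0r. Qed.

Lemma cpoly_opMX P A x : cpoly_op (P * 'X) A x = cpoly_op P A (A x).
Proof.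
rewrite (@cpoly_op_widen (size P).+1); last first.
  by rewrite (leq_trans (size_polyMleq _ _))// size_polyX addn2.
rewrite big_ord_recl coefMX /= scale0r add0r.
by apply: eq_bigr => i _; rewrite coefMX /= -iterSr.
Qed.

Lemma bop_cpoly P A : bounded_op A -> bounded_op (cpoly_op P A).
Proof.
move=> bA; apply: (bop_sum (T := fun i : 'I__ => fun x => P`_i *: iter i A x)) => i.
by apply: bop_scale; exact: bop_iter.
Qed.

Lemma cpoly_op_comm P A x : bounded_op A -> cpoly_op P A (A x) = A (cpoly_op P A x).
Proof.
move=> bA; elim/poly_ind: P x => [|P c IH] x.
  by rewrite !cpoly_op0 (bop0 bA).
by rewrite !cpoly_opD !cpoly_opMX !cpoly_opC IH (bopD bA) (bopZ bA).
Qed.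

Lemma cpoly_opM P Q A x : bounded_op A ->
  cpoly_op (P * Q) A x = cpoly_op P A (cpoly_op Q A x).
Proof.
move=> bA; elim/poly_ind: P x => [|P c IH] x.
  by rewrite mul0r !cpoly_op0.
rewrite mulrDl mul_polyC mulrAC !cpoly_opD !cpoly_opMX cpoly_opZ cpoly_opC.
by rewrite IH cpoly_op_comm.
Qed.

(** Half of the spectral mapping theorem: [P] splits, so P(A) is a nonzero scalar times a product of
    invertible factors A - z. *)
Lemma cpoly_op_invertible P A : bounded_op A -> P != 0 ->
  (forall z, root P z -> invertible (fun x => A x - z *: x)) ->
  invertible (cpoly_op P A).
Proof.
move=> bA P0; have [r PE] := closed_field_poly_normal P.
have lc0 : lead_coef P != 0 by rewrite lead_coef_eq0.
move=> inv; rewrite PE.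
have -> : forall Q, cpoly_op (lead_coef P *: Q) A =
    (fun x => lead_coef P *: cpoly_op Q A x).
  by move=> Q; apply/funext => x; rewrite cpoly_opZ.
apply: invertible_scale => //.
have {}inv z : z \in r -> invertible (fun x => A x - z *: x).
  by move=> zr; apply: inv; rewrite PE rootZ// root_prod_XsubC.
elim: r {PE} inv => [|z r IH] inv.
  rewrite big_nil (_ : cpoly_op 1 A = idfun); first exact: invertible_id.
  by apply/funext => x; rewrite cpoly_opC scale1r.
rewrite big_cons.
have -> : cpoly_op (('X - z%:P) * \prod_(w <- r) ('X - w%:P)) A =
    (fun x => A x - z *: x) \o cpoly_op (\prod_(w <- r) ('X - w%:P)) A.
  apply/funext => x /=; rewrite cpoly_opM//; set y := cpoly_op (\prod_(_ <- _) _) A x.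
  rewrite -polyCN cpoly_opD -['X]mul1r cpoly_opMX -[1]/(1%:P) !cpoly_opC.
  by rewrite scale1r scaleNr.
apply: invertible_comp; first by apply: inv; rewrite inE eqxx.
by apply: IH => w wr; apply: inv; rewrite inE wr orbT.
Qed.

Lemma bop_poly p A : bounded_op A -> bounded_op (poly_op p A).
Proof. by rewrite poly_opE; apply: bop_cpoly. Qed.

Lemma poly_opM p q A x : bounded_op A ->
  poly_op (p * q) A x = poly_op p A (poly_op q A x).
Proof. by move=> bA; rewrite !poly_opE rmorphM cpoly_opM. Qed.

Lemma poly_opB p q A x : poly_op (p - q) A x = poly_op p A x - poly_op q A x.
Proof.
rewrite !poly_opE rmorphB cpoly_opD -scaleN1r cpoly_opZ scaleN1r//.
Qed.

Lemma poly_opC (a : R) A x : poly_op a%:P A x = a%:C *: x.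
Proof. by rewrite poly_opE map_polyC cpoly_opC. Qed.

Lemma poly_opX A x : poly_op 'X A x = A x.
Proof.
by rewrite poly_opE map_polyX -['X]mul1r cpoly_opMX -[1]/(1%:P) cpoly_opC scale1r.
Qed.

End Polynomials.

(** * Spectrum and polynomial norms of self-adjoint operators *)

Section SelfAdjoint.
Context {R : realType} {H : completeNormedModType R[i]}.
Variable dot : {dot H for Num.conj}.
Hypothesis norm_dot : forall x : H, `|x| ^+ 2 = dot x x.
Hypothesis H_nonzero : exists x : H, x != 0.
Implicit Types (A B S : H -> H) (p q : {poly R}).

Definition self_adjoint A := bounded_op A /\ forall x y, dot (A x) y = dot x (A y).

Lemma self_adjoint_poly p A : self_adjoint A -> self_adjoint (poly_op p A).
Proof.
move=> [bA sA]; split; first exact: bop_poly.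
elim/poly_ind: p => [|p c IH] x y.
  by rewrite -[0]/(0%:P) !poly_opC (_ : 0%:C = 0)// !scale0r linear0l linear0r.
rewrite -[c%:P]opprK -polyCN !poly_opB !poly_opM// !poly_opX !poly_opC.
rewrite linearBl linearBr /= IH sA linearZl_LR [dot _ (_ *: _)]dotZr conjc_real.
by rewrite poly_opE cpoly_op_comm.
Qed.

(** As <A x, x> is real, <(A - z) x, x> has imaginary part - Im z ||x||^2, so A - z is coercive
    unless z is real. *)
Lemma self_adjoint_spectrum A z : self_adjoint A -> spectrum A z ->
  z = (complex.Re z)%:C.
Proof.
move=> [bA sA] sz; apply/eqP; rewrite eq_complex /= eqxx /=.
apply: contrapT => /negP z0; apply: sz.
have i0 : 0 < `|complex.Im z| by rewrite normr_gt0.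
apply: (lax_milgram norm_dot (bop_sub_scalar z bA) i0) => x.
have iA : complex.Im (dot (A x) x) = 0.
  have : conjc (dot (A x) x) = dot (A x) x by rewrite -dotC sA.
  by case: (dot (A x) x) => a b [] /=; lra.
rewrite -[cnorm x ^+ 2]ger0_norm ?sqr_ge0// -normrM.
rewrite (le_trans _ (normr_Im_le _))// linearBl /= linearZl_LR /= dotxx//.
move: iA; case: (dot _ _) => a b /= ->; case: z {i0 z0} => c d /=.
by rewrite mulr0 add0r add0r normrN.
Qed.

Lemma positive_spectrum A (t : R) : bounded_op A ->
  (forall x, 0 <= complex.Re (dot (A x) x)) -> spectrum A t%:C -> 0 <= t.
Proof.
move=> bA pA st; rewrite leNgt; apply/negP => t0; apply: st.
have t0' : 0 < - t by rewrite oppr_gt0.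
apply: (lax_milgram norm_dot (bop_sub_scalar t%:C bA) t0') => x.
rewrite (le_trans _ (Re_le_cnorm _))// linearBl /= linearZl_LR /= dotxx//.
by move: (pA x); case: (dot _ _) => a b /=; rewrite mul0r subr0; lra.
Qed.

(* [||S||] or [-||S||] lies in the spectrum of the self-adjoint [S = p(A)]:
   otherwise [S^2 - ||S||^2] is bounded below, contradicting that [||S||] is
   approached.  Factoring [p^2 - ||S||^2] over the complex numbers then
   produces a spectral value of [A] at which [|p|] equals [||S||]. *)
Lemma self_adjoint_poly_norm p A (m : R) : self_adjoint A -> 0 <= m ->
  (forall t : R, spectrum A t%:C -> `|p.[t]| <= m) ->
  forall x, cnorm (poly_op p A x) <= m * cnorm x.
Proof.
move=> saA m0 pm; have [bA _] := saA; pose S := poly_op p A.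
have [bS sS] := self_adjoint_poly p saA; rewrite -/S in bS sS.
suff Nm : opnorm S <= m.
  by move=> x; rewrite (le_trans (ler_opnorm x bS))// ler_wpM2r ?cnorm_ge0.
set N := opnorm S; rewrite leNgt; apply/negP => mN.
have N0 : 0 < N := le_lt_trans m0 mN.
pose q := p ^+ 2 - (N ^+ 2)%:P.
have qS x : poly_op q A x = S (S x) - (N ^+ 2)%:C *: x.
  by rewrite poly_opB poly_opC expr2 poly_opM.
suff [t st] : exists2 t : R, spectrum A t%:C & q.[t] = 0.
  rewrite !hornerE => qt; have := pm t st; rewrite leNgt => /negP; apply.
  apply: (lt_le_trans mN); rewrite -(@ler_pXn2r _ 2) ?nnegrE ?(ltW N0)//.
  by rewrite real_normK ?num_real//; lra.
have [q0|q0] := eqVneq q 0.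
  have [z sz] := spectrum_neq0 H_nonzero bA.
  exists (complex.Re z); last by rewrite q0 horner0.
  by rewrite -(self_adjoint_spectrum saA sz).
apply: contrapT => nt.
have : invertible (poly_op q A).
  rewrite poly_opE; apply: cpoly_op_invertible => //; first by rewrite map_poly_eq0.
  move=> z rz; apply: contrapT => sz; apply: nt.
  have zE := self_adjoint_spectrum saA sz.
  exists (complex.Re z); first by rewrite -zE.
  by move: rz; rewrite zE /root horner_map => /eqP/(congr1 (@complex.Re R)).
case/invertible_bijP => _ [c c0 hc] _; have [v v0] := H_nonzero.
(* In ||S^2 x - N^2 x||^2 the cross term is -2 N^2 ||S x||^2 by self-adjointness, and ||S^2 x|| <= N
   ||S x||. Solved for ||S x||^2, this bounds it by M ||x||^2 with M < N^2. *)
have c2 x : c ^+ 2 * cnorm x ^+ 2 <=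
    N ^+ 2 * (N ^+ 2 * cnorm x ^+ 2 - cnorm (S x) ^+ 2).
  have h1 : (c * cnorm x) ^+ 2 <= cnorm (S (S x) - (N ^+ 2)%:C *: x) ^+ 2.
    by rewrite -qS ler_pXn2r ?nnegrE ?mulr_ge0 ?cnorm_ge0 ?(ltW c0).
  have h2 : cnorm (S (S x)) ^+ 2 <= (N * cnorm (S x)) ^+ 2.
    by rewrite ler_pXn2r ?nnegrE ?mulr_ge0 ?cnorm_ge0 ?(ltW N0)// ler_opnorm.
  move: h1; rewrite (cnorm_sqrB norm_dot) dotZr conjc_real sS dotxx// -rmorphM.
  rewrite cnormZ cnorm_real [complex.Re _]/=.
  move: h2; rewrite !exprMn real_normK ?num_real//; lra.
pose M := N ^+ 2 - c ^+ 2 / N ^+ 2.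
have N2 : 0 < N ^+ 2 by rewrite exprn_gt0.
have SM x : cnorm (S x) ^+ 2 <= M * cnorm x ^+ 2.
  have -> : M * cnorm x ^+ 2 =
      (N ^+ 2)^-1 * (N ^+ 2 * (N ^+ 2 * cnorm x ^+ 2) - c ^+ 2 * cnorm x ^+ 2).
    by rewrite /M; field; rewrite gt_eqF.
  by rewrite ler_pdivlMl//; have := c2 x; lra.
have M0 : 0 <= M.
  have v2 : 0 < cnorm v ^+ 2 by rewrite exprn_gt0// lt_def cnorm_eq0 v0 cnorm_ge0.
  by rewrite -(ler_pM2r v2) mul0r (le_trans _ (SM v)) ?sqr_ge0.
have : N <= Num.sqrt M.
  apply: opnorm_le; first exact: sqrtr_ge0.
  move=> x; rewrite -(@ler_pXn2r _ 2) ?nnegrE ?mulr_ge0 ?cnorm_ge0 ?sqrtr_ge0//.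
  by rewrite exprMn sqr_sqrtr.
rewrite -(@ler_pXn2r _ 2) ?nnegrE ?sqrtr_ge0 ?(ltW N0)// sqr_sqrtr// /M.
by rewrite lerBrDr gerDl leNgt divr_gt0// exprn_gt0.
Qed.

End SelfAdjoint.

(** * Existence and product rule of the functional calculus *)

Section FunctionalCalculus.
Context {R : realType} {H : completeNormedModType R[i]}.
Variable dot : {dot H for Num.conj}.
Hypothesis norm_dot : forall x : H, `|x| ^+ 2 = dot x x.
Hypothesis H_nonzero : exists x : H, x != 0.
Implicit Types (A B C D : H -> H) (f g h : R -> R) (p q : {poly R}).

(* The epsilon form of [is_fun_calc].  Everything needed about [fun_calc f A]
   holds for any such [B], so uniqueness of the calculus plays no role. *)
Definition fun_approx f A B := bounded_op B /\ forall e : R, 0 < e ->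
  exists p, (forall t : R, spectrum A t%:C -> `|p.[t] - f t| <= e) /\
    forall x, cnorm (poly_op p A x - B x) <= e * cnorm x.

Lemma fun_calc_approx f A B : bounded_op A -> is_fun_calc f A B -> fun_approx f A B.
Proof.
move=> bA [bB [p [pf pB]]]; split=> // e e0.
have n1 := pf e e0; have /cvgrPdist_le /(_ e e0) n2 := pB.
have [n [h1 h2]] := filter_ex (filterI n1 n2).
exists (p n); split=> // x.
have bn : bounded_op (fun x => poly_op (p n) A x - B x).
  by apply: bop_sub => //; exact: bop_poly.
rewrite (le_trans (ler_opnorm x bn))// ler_wpM2r ?cnorm_ge0//.
by move: h2; rewrite sub0r normrN ger0_norm// opnorm_ge0.
Qed.

(** [self_adjoint_poly_norm] turns uniform convergence on the spectrum into a Cauchy condition in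
    operator norm. The limit is taken pointwise in x, but the rate 1/(n+1) survives it, which makes
    it a limit in norm. *)
Lemma fun_calc_ex f A : self_adjoint dot A ->
  (forall e : R, 0 < e ->
    exists p, forall t : R, spectrum A t%:C -> `|p.[t] - f t| <= e) ->
  is_fun_calc f A !=set0.
Proof.
move=> saA approx; have [bA _] := saA.
have /choice[p hp] : forall k : nat, exists p, forall t : R, spectrum A t%:C ->
    `|p.[t] - f t| <= k.+1%:R^-1.
  by move=> k; apply: approx; rewrite invr_gt0.
have pC m n x : cnorm (poly_op (p m) A x - poly_op (p n) A x) <=
    (m.+1%:R^-1 + n.+1%:R^-1) * cnorm x.
  rewrite -poly_opB; apply: (self_adjoint_poly_norm norm_dot H_nonzero saA).
    by rewrite addr_ge0 ?invr_ge0.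
  move=> t st; have h1 := hp m t st; have h2 := hp n t st; rewrite hornerD hornerN.
  have -> : (p m).[t] - (p n).[t] = ((p m).[t] - f t) - ((p n).[t] - f t) by ring.
  by rewrite (le_trans (ler_normB _ _))// lerD.
have /choice[B hB] : forall x, exists l, cnorm_cvg (fun n => poly_op (p n) A x) l.
  move=> x; apply: cnorm_cauchy_cvg => e e0.
  have c0 : 0 < 2 * (cnorm x + 1) by rewrite mulr_gt0// ltr_wpDl ?cnorm_ge0.
  have [N hN] := natSinv_small (divr_gt0 e0 c0); exists N => m n Nm Nn.
  rewrite (le_trans (pC m n x))//; have := hN m Nm; have := hN n Nn.
  rewrite !ler_pdivlMr//; have := cnorm_ge0 x.
  have : 0 <= m.+1%:R^-1 :> R by rewrite invr_ge0.
  have : 0 <= n.+1%:R^-1 :> R by rewrite invr_ge0.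
  by move: (m.+1%:R^-1) (n.+1%:R^-1) => i j; nra.
have pB n x : cnorm (poly_op (p n) A x - B x) <= n.+1%:R^-1 * cnorm x.
  apply: (@le_epsM _ (cnorm x + 1)) => [|e e0]; first by rewrite addr_ge0 ?cnorm_ge0.
  have [N1 hN1] := natSinv_small e0; have [N2 hN2] := hB x e e0.
  pose k := maxn N1 N2.
  rewrite (le_trans (ler_cnorm_dist (poly_op (p k) A x) _ _))//.
  have := hN1 k (leq_maxl _ _); have := hN2 k (leq_maxr _ _).
  have := pC n k x; have := cnorm_ge0 x.
  by move: (k.+1%:R^-1) (n.+1%:R^-1) => i j; nra.
have bp n : bounded_op (poly_op (p n) A) by exact: bop_poly.
have linB : linear B.
  move=> a x y; apply/eqP; rewrite -subr_eq0; apply/eqP.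
  apply: (@cnorm_eps0 _ _ (cnorm (a *: x + y) + cnorm a * cnorm x + cnorm y)).
    by rewrite !addr_ge0 ?mulr_ge0 ?cnorm_ge0.
  move=> e e0; have [n /(_ n (leqnn n)) hn] := natSinv_small e0.
  have -> : B (a *: x + y) - (a *: B x + B y) =
      - (poly_op (p n) A (a *: x + y) - B (a *: x + y)) +
      a *: (poly_op (p n) A x - B x) + (poly_op (p n) A y - B y).
    rewrite (bopD (bp n)) (bopZ (bp n)) scalerBr opprB -[RHS]addrA.
    by rewrite [X in _ = _ + X]addrACA -opprD addrA subrK.
  rewrite (le_trans (ler_cnormD _ _))// (le_trans (lerD (ler_cnormD _ _) (lexx _)))//.
  rewrite cnormN cnormZ.
  have h1 := pB n (a *: x + y); have h2 := pB n x; have h3 := pB n y.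
  have c1 := cnorm_ge0 (a *: x + y); have c2 := cnorm_ge0 x; have c3 := cnorm_ge0 y.
  have c4 := cnorm_ge0 a.
  have {}h2 : cnorm a * cnorm (poly_op (p n) A x - B x) <= cnorm a * (e * cnorm x).
    by rewrite ler_wpM2l// (le_trans h2)// ler_wpM2r.
  have {}h1 := le_trans h1 (ler_wpM2r c1 hn).
  have {}h3 := le_trans h3 (ler_wpM2r c3 hn).
  by rewrite (le_trans (lerD (lerD h1 h2) h3))//; lra.
have bB : bounded_op B.
  have [K K0 hK] := bop_bound (bp 0%N).
  split=> //; exists (K + 1) => x; have := pB 0%N x; have := hK x.
  rewrite invr1; have := ler_cnorm_dist (poly_op (p 0%N) A x) (B x) 0.
  by rewrite !subr0 cnorm_distC; lra.
exists B; split=> //; exists p; split=> [e e0|].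
  have [N hN] := natSinv_small e0; exists N => // n Nn t st.
  exact: le_trans (hp n t st) (hN n Nn).
apply/cvgrPdist_le => e e0.
have [N hN] := natSinv_small e0; exists N => // n Nn /=.
rewrite sub0r normrN ger0_norm; last by apply: opnorm_ge0; exact: bop_sub.
apply: opnorm_le; first exact: ltW.
by move=> x; rewrite (le_trans (pB n x))// ler_wpM2r ?cnorm_ge0// hN.
Qed.

Lemma fun_approx_id A : bounded_op A -> fun_approx id A A.
Proof.
move=> bA; split=> // e e0; exists 'X; split=> [t _|x].
  by rewrite hornerX subrr normr0 ltW.
by rewrite poly_opX subrr cnorm0 mulr_ge0 ?cnorm_ge0// ltW.
Qed.

Lemma fun_approx_norm f A B (m : R) : self_adjoint dot A -> fun_approx f A B ->
  0 <= m -> (forall t : R, spectrum A t%:C -> `|f t| <= m) ->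
  forall x, cnorm (B x) <= m * cnorm x.
Proof.
move=> saA [bB hB] m0 fm x; apply: (@le_epsM _ (2 * cnorm x)) => [|e e0].
  by rewrite mulr_ge0 ?cnorm_ge0.
have [p [pf pB]] := hB e e0.
have := ler_cnorm_dist (poly_op p A x) (B x) 0; rewrite !subr0 cnorm_distC.
have me : 0 <= m + e by rewrite addr_ge0// ltW.
have := self_adjoint_poly_norm norm_dot H_nonzero saA (p := p) me _ x.
have pm (t : R) : spectrum A t%:C -> `|p.[t]| <= m + e.
  move=> st; have -> : p.[t] = f t + (p.[t] - f t) by ring.
  by rewrite (le_trans (ler_normD _ _))// lerD ?fm ?pf.
by move=> /(_ pm); have := pB x; lra.
Qed.

Lemma fun_approx_self_adjoint f A B : self_adjoint dot A -> fun_approx f A B ->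
  self_adjoint dot B.
Proof.
move=> saA [bB hB]; split=> // x y; apply/eqP; rewrite -subr_eq0; apply/eqP.
apply: (@cnorm_eps0 _ _ (2 * cnorm x * cnorm y)) => [|e e0].
  by rewrite !mulr_ge0 ?cnorm_ge0.
have [p [_ pB]] := hB e e0; have [_ sp] := self_adjoint_poly p saA.
have -> : dot (B x) y - dot x (B y) =
    dot x (poly_op p A y - B y) - dot (poly_op p A x - B x) y.
  by rewrite linearBr linearBl /= -sp; ring.
rewrite (le_trans (ler_cnormB _ _))//.
have h1 := cauchy_schwarz norm_dot x (poly_op p A y - B y).
have h2 := cauchy_schwarz norm_dot (poly_op p A x - B x) y.
have h3 := ler_wpM2l (cnorm_ge0 x) (pB y).
have h4 := ler_wpM2r (cnorm_ge0 y) (pB x).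
by lra.
Qed.

Lemma fun_approx_mul f g h A B C D (m : R) : self_adjoint dot A -> 0 <= m ->
  fun_approx f A B -> fun_approx g A C -> fun_approx h A D ->
  (forall t : R, spectrum A t%:C -> [/\ `|f t| <= m, `|g t| <= m & f t * g t = h t]) ->
  forall x, B (C x) = D x.
Proof.
move=> saA m0 fB gC hD fg x; have [bA _] := saA.
apply/eqP; rewrite -subr_eq0; apply/eqP.
(* Four errors, in units of e: ||C x|| from p(A) - B at C x; then, as multiples of ||x||, m + 1 from
   p(A) applied to q(A) - C, 2 m + 2 from p q - r, and 1 from r(A) - D. Capping e at 1 absorbs e^2
   into e. *)
apply: (@cnorm_eps0 _ _ (cnorm (C x) + (3 * m + 4) * cnorm x)) => [|e0 e0_gt0].
  by rewrite addr_ge0 ?mulr_ge0 ?addr_ge0 ?mulr_ge0 ?cnorm_ge0.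
pose e := Num.min e0 1; have e_gt0 : 0 < e by rewrite lt_min e0_gt0 ltr01.
have ee0 : e <= e0 by rewrite ge_min lexx.
have e1 : e <= 1 by rewrite ge_min lexx orbT.
apply: (@le_trans _ _ ((cnorm (C x) + (3 * m + 4) * cnorm x) * e)); last first.
  rewrite ler_wpM2l// addr_ge0 ?mulr_ge0 ?addr_ge0 ?mulr_ge0 ?cnorm_ge0//.
have [bB /(_ e e_gt0)[p [pf pB]]] := fB; have [bC /(_ e e_gt0)[q [qg qC]]] := gC.
have [bD /(_ e e_gt0)[r [rh rD]]] := hD.
have me : 0 <= m + e by rewrite addr_ge0// ltW.
have ee : e * e <= e by rewrite ler_piMr// ltW.
have pm (t : R) : spectrum A t%:C -> `|p.[t]| <= m + e.
  move=> st; have -> : p.[t] = f t + (p.[t] - f t) by ring.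
  by rewrite (le_trans (ler_normD _ _))// lerD ?pf//; case: (fg t st).
have pqr (t : R) : spectrum A t%:C -> `|(p * q - r).[t]| <= (2 * m + 2) * e.
  move=> st; have [ft gt fgt] := fg t st.
  rewrite hornerD hornerN hornerM.
  have -> : p.[t] * q.[t] - r.[t] = p.[t] * (q.[t] - g t) + g t * (p.[t] - f t)
    - (r.[t] - h t) by rewrite -fgt; ring.
  rewrite (le_trans (ler_normB _ _))//.
  rewrite (le_trans (lerD (ler_normD _ _) (lexx _)))// !normrM.
  have h1 := ler_pM (normr_ge0 _) (normr_ge0 _) (pm t st) (qg t st).
  have h2 := ler_pM (normr_ge0 _) (normr_ge0 _) gt (pf t st).
  have h3 := rh t st; lra.
have m2 : 0 <= (2 * m + 2) * e by rewrite mulr_ge0 ?addr_ge0 ?mulr_ge0// ltW.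
have n1 := pB (C x).
have n2 := self_adjoint_poly_norm norm_dot H_nonzero saA me pm
  (poly_op q A x - C x).
have n3 := self_adjoint_poly_norm norm_dot H_nonzero saA m2 pqr x.
have n4 := rD x; have n5 := qC x.
rewrite poly_opB poly_opM// in n3; rewrite (bopB (bop_poly p bA)) in n2.
set w1 := poly_op p A (C x) in n1 n2; set w2 := poly_op p A _ in n2 n3.
set w3 := poly_op r A x in n3 n4.
rewrite (le_trans (ler_cnorm_dist w1 _ _))// cnorm_distC.
have c1 := ler_cnorm_dist w2 w1 (D x); have c2 := ler_cnorm_dist w3 w2 (D x).
rewrite (cnorm_distC w1 w2) in c1.
have n6 : cnorm (w2 - w1) <= (m + 1) * (e * cnorm x).
  rewrite (le_trans n2)// ler_pM ?cnorm_ge0//; lra.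
lra.
Qed.

Lemma op_powP A (s K : R) : self_adjoint dot A -> 0 < K ->
  (forall t : R, spectrum A t%:C -> 0 <= t <= K) -> 0 <= s <= 1 ->
  fun_approx (fun t => t `^ s) A (op_pow A s).
Proof.
move=> saA K0 sK s01; have [bA _] := saA; apply: fun_calc_approx => //.
apply: xgetPex; apply: fun_calc_ex => // e e0.
by have [p hp] := powR_poly_approx s01 K0 e0; exists p => t /sK; exact: hp.
Qed.

Lemma powR_norm_le (s t K : R) : 0 <= s -> 0 <= t <= K -> `|t `^ s| <= K `^ s.
Proof.
move=> s0 /andP[t0 tK]; rewrite ger0_norm ?powR_ge0//.
by apply: ge0_ler_powR; rewrite ?nnegrE// (le_trans t0).
Qed.

Lemma op_pow_mul A (s t u K : R) : self_adjoint dot A -> 0 < K ->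
  (forall t : R, spectrum A t%:C -> 0 <= t <= K) -> 0 <= s <= 1 -> 0 <= t <= 1 ->
  s + t = u -> 0 < u <= 1 ->
  forall x, op_pow A s (op_pow A t x) = op_pow A u x.
Proof.
move=> saA K0 sK s01 t01 stu /andP[u0 u1].
have u01 : 0 <= u <= 1 by rewrite ltW.
pose m := Num.max (K `^ s) (K `^ t).
have m0 : 0 <= m by rewrite le_max powR_ge0.
apply: (fun_approx_mul saA m0 (op_powP saA K0 sK s01) (op_powP saA K0 sK t01)
  (op_powP saA K0 sK u01)) => v sv; have vK := sK v sv; split.
- by rewrite le_max powR_norm_le//; case/andP: s01.
- by rewrite le_max (powR_norm_le _ vK) ?orbT//; case/andP: t01.
- by rewrite -stu powRD// stu gt_eqF.
Qed.

(** The product rule is applied to 1 * t^1 = t, with the identity operator standing for 1 and [A]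
    for t. *)
Lemma op_pow1 A (K : R) : self_adjoint dot A -> 0 < K ->
  (forall t : R, spectrum A t%:C -> 0 <= t <= K) -> forall x, op_pow A 1 x = A x.
Proof.
move=> saA K0 sK x; have [bA _] := saA; have o01 : 0 <= (1 : R) <= 1 by rewrite ler01 lexx.
have m0 : 0 <= Num.max 1 K by rewrite le_max ler01.
have c1 : fun_approx (fun=> 1) A idfun.
  split; first exact: bop_id.
  move=> e e0; exists 1%:P; split=> [t _|y]; first by rewrite hornerC subrr normr0 ltW.
  by rewrite poly_opC scale1r subrr cnorm0 mulr_ge0 ?cnorm_ge0// ltW.
apply: (fun_approx_mul saA m0 c1 (op_powP saA K0 sK o01) (fun_approx_id bA)) => t st.
have /andP[t0 tK] := sK t st; rewrite powRr1// mul1r normr1 le_max lexx.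
by rewrite le_max ger0_norm// tK orbT.
Qed.

Lemma bop_pow A (s K : R) : self_adjoint dot A -> 0 < K ->
  (forall t : R, spectrum A t%:C -> 0 <= t <= K) -> 0 <= s <= 1 ->
  bounded_op (op_pow A s).
Proof. by move=> saA K0 sK s01; case: (op_powP saA K0 sK s01). Qed.

Lemma op_pow_norm A (s K : R) : self_adjoint dot A -> 0 < K ->
  (forall t : R, spectrum A t%:C -> 0 <= t <= K) -> 0 <= s <= 1 ->
  forall x, cnorm (op_pow A s x) <= K `^ s * cnorm x.
Proof.
move=> saA K0 sK s01.
apply: (fun_approx_norm saA (op_powP saA K0 sK s01)) => [|t /sK tK].
  exact: powR_ge0.
by apply: powR_norm_le => //; case/andP: s01.
Qed.

Lemma positive_spectrum_bound A (K : R) : bounded_op A ->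
  (forall x, 0 <= complex.Re (dot (A x) x)) -> 0 <= K ->
  (forall x, cnorm (A x) <= K * cnorm x) ->
  forall t : R, spectrum A t%:C -> 0 <= t <= K.
Proof.
move=> bA pA K0 hK t st; have t0 := positive_spectrum norm_dot bA pA st.
by have := spectrum_le norm_dot bA hK K0 st; rewrite cnorm_real ger0_norm// t0.
Qed.

(* Positivity of the square root: it is the square of the fourth root. *)
Lemma op_sqrtP A : self_adjoint dot A -> (forall x, 0 <= complex.Re (dot (A x) x)) ->
  [/\ self_adjoint dot (op_pow A 2^-1), forall x, op_pow A 2^-1 (op_pow A 2^-1 x) = A x
    & forall x, 0 <= complex.Re (dot (op_pow A 2^-1 x) x)].
Proof.
move=> saA pA; have [bA _] := saA; have [K K0 hK] := bop_bound bA.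
have sK := positive_spectrum_bound bA pA (ltW K0) hK.
have h2 : 0 <= (2^-1 : R) <= 1 by lra.
have h4 : 0 <= (4^-1 : R) <= 1 by lra.
split; first exact: fun_approx_self_adjoint saA (op_powP saA K0 sK h2).
  move=> x; rewrite (op_pow_mul saA K0 sK h2 h2 (u := 1)) ?(op_pow1 saA K0 sK)//; lra.
move=> x; have [_ s4] := fun_approx_self_adjoint saA (op_powP saA K0 sK h4).
rewrite -(op_pow_mul saA K0 sK h4 h4); [|lra|lra].
by rewrite s4 dotxx//= sqr_ge0.
Qed.

End FunctionalCalculus.

(** * Polar decomposition and Aluthge transform *)

Section AluthgeTransform.
Context {R : realType} {H : completeNormedModType R[i]}.
Variable dot : {dot H for Num.conj}.
Hypothesis norm_dot : forall x : H, `|x| ^+ 2 = dot x x.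
Hypothesis H_nonzero : exists x : H, x != 0.
Implicit Types (A B Q S T U : H -> H).

Lemma self_adjoint_gram T : bounded_op T -> self_adjoint dot (adjoint dot T \o T).
Proof.
move=> bT; split; first by apply: bop_comp => //; exact: bop_adjoint.
move=> x y /=; rewrite -(adjointP norm_dot)// dotC -(adjointP norm_dot)//.
by rewrite -dotC.
Qed.

Lemma dot_gram T x : bounded_op T ->
  dot ((adjoint dot T \o T) x) x = (cnorm (T x) ^+ 2)%:C.
Proof.
move=> bT; have [_ ->] := self_adjoint_gram bT.
by rewrite /= -(adjointP norm_dot)// (dotxx norm_dot).
Qed.

Lemma modulusP T : bounded_op T ->
  [/\ self_adjoint dot (modulus dot T), forall x, cnorm (modulus dot T x) = cnorm (T x)
    & forall x, 0 <= complex.Re (dot (modulus dot T x) x)].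
Proof.
move=> bT; have saA := self_adjoint_gram bT.
have [x|saQ QQ pQ] := op_sqrtP norm_dot H_nonzero saA.
  by rewrite dot_gram// sqr_ge0.
split=> // x; apply/eqP; rewrite -(@eqrXn2 _ 2) ?cnorm_ge0//.
rewrite -(inj_eq (@complexI R)) -(dotxx norm_dot).
by have [_ <-] := saQ; rewrite QQ dot_gram.
Qed.

Lemma cnorm_sqrD_orth x y : dot x y = 0 ->
  cnorm (x + y) ^+ 2 = cnorm x ^+ 2 + cnorm y ^+ 2.
Proof. by move=> xy; rewrite (cnorm_sqrD norm_dot) xy /= mulr0 addr0. Qed.

Lemma ler_cnorm_orth x y : dot x y = 0 -> cnorm x <= cnorm (x + y).
Proof.
move=> xy; rewrite -(@ler_pXn2r _ 2) ?nnegrE ?cnorm_ge0//.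
by rewrite cnorm_sqrD_orth// lerDl sqr_ge0.
Qed.

(* If [Q] is self-adjoint and [||Q x|| = ||T x||], the closure of the relation
   [{(Q y + n, T y)}], with [n] orthogonal to the range of [Q], is the graph of
   the partial isometry of the polar decomposition. *)
Lemma polar_factor_ex Q T : self_adjoint dot Q -> bounded_op T ->
  (forall x, cnorm (Q x) = cnorm (T x)) ->
  exists U, [/\ partial_isometry dot U, T = U \o Q &
    forall x, U x = 0 <-> T x = 0].
Proof.
move=> [bQ sQ] bT QT; pose perp n := forall z, dot (Q z) n = 0.
pose G x u := forall e : R, 0 < e -> exists y n,
  [/\ perp n, cnorm (x - Q y - n) <= e & cnorm (u - T y) <= e].
have Gtotal x : exists u, G x u.
  have [||p [pQ xp]] := @orthogonal_projection _ _ _ norm_dot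
    [set Q y | y in setT] _ _ x.
  - by exists 0; rewrite ?(bop0 bQ).
  - move=> a _ _ [y _ <-] [z _ <-].
    by exists (a *: y + z); rewrite // (bopD bQ) (bopZ bQ).
  have perp_xp : perp (x - p) by move=> z; rewrite dotC xp ?conjc0//; exists z.
  have /choice[y hy] : forall k : nat, exists y, cnorm (p - Q y) <= k.+1%:R^-1.
    move=> k; have k0 : 0 < k.+1%:R^-1 :> R by rewrite invr_gt0.
    by have [_ [y _ <-]] := pQ _ k0; exists y.
  have [|u uy] := @cnorm_cauchy_cvg R H (fun k => T (y k)).
    move=> e e0; have e2 : 0 < e / 2 by rewrite divr_gt0.
    have [N hN] := natSinv_small e2; exists N => m n Nm Nn.
    rewrite -(bopB bT) -QT (bopB bQ).
    rewrite (le_trans (ler_cnorm_dist p _ _))// cnorm_distC.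
    have := le_trans (hy m) (hN m Nm); have := le_trans (hy n) (hN n Nn); lra.
  exists u => e e0; have [N1 hN1] := natSinv_small e0; have [N2 hN2] := uy e e0.
  exists (y (maxn N1 N2)), (x - p); split=> //.
    have -> : x - Q (y (maxn N1 N2)) - (x - p) = p - Q (y (maxn N1 N2)).
      by rewrite opprB addrC addrA subrK.
    by rewrite (le_trans (hy _))// hN1// leq_maxl.
  by rewrite cnorm_distC hN2// leq_maxr.
have Gle x u : G x u -> cnorm u <= cnorm x.
  move=> xu; apply: (@le_epsM _ 2) => // e e0; have [y [n [nP h1 h2]]] := xu e e0.
  have h3 := ler_cnorm_orth (nP y); rewrite QT in h3.
  have h4 := lerB_cnorm u (T y); have h5 := lerB_cnorm (Q y + n) x.
  rewrite cnorm_distC opprD addrA in h5; lra.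
have Glin a x y u v : G x u -> G y v -> G (a *: x + y) (a *: u + v).
  move=> xu yv e e0; have a1 : 0 < cnorm a + 1 by rewrite ltr_wpDl ?cnorm_ge0.
  have [y1 [n1 [p1 h1 k1]]] := xu _ (divr_gt0 e0 a1).
  have [y2 [n2 [p2 h2 k2]]] := yv _ (divr_gt0 e0 a1).
  have comb (w1 w2 : H) : cnorm w1 <= e / (cnorm a + 1) ->
      cnorm w2 <= e / (cnorm a + 1) -> cnorm (a *: w1 + w2) <= e.
    rewrite !ler_pdivlMr// => c1 c2; rewrite -(ler_pM2r a1).
    rewrite (le_trans (ler_wpM2r (ltW a1) (ler_cnormD _ _)))// cnormZ.
    have := ler_wpM2l (cnorm_ge0 a) c1; lra.
  exists (a *: y1 + y2), (a *: n1 + n2); split.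
  - by move=> z; rewrite linearDr /= dotZr p1 p2 mulr0 addr0.
  - rewrite (_ : _ - _ = a *: (x - Q y1 - n1) + (y - Q y2 - n2)) ?comb//.
    rewrite (bopD bQ) (bopZ bQ) !scalerBr [RHS]addrACA.
    by rewrite [X in _ = X + _]addrACA -!opprD.
  - rewrite (_ : _ - _ = a *: (u - T y1) + (v - T y2)) ?comb//.
    by rewrite (bopD bT) (bopZ bT) scalerBr opprD addrACA.
have Guniq x u v : G x u -> G x v -> u = v.
  move=> xu xv; have /Gle := Glin (-1) _ _ _ _ xu xv.
  rewrite !scaleN1r addNr cnorm0 => h.
  apply/eqP; rewrite eq_sym -subr_eq0 -cnorm_eq0 eq_le cnorm_ge0 andbT.
  by rewrite addrC.
have /choice[U GU] := Gtotal.
have bU : bounded_op U.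
  split=> [a x y|]; first by apply: Guniq (GU _) (Glin _ _ _ _ _ (GU _) (GU _)).
  by exists 1 => x; rewrite mul1r; exact: Gle.
have Uperp n : perp n -> U n = 0.
  move=> nP; apply: Guniq (GU _) _ => e e0; exists 0, n; split=> //.
    by rewrite (bop0 bQ) subr0 subrr cnorm0 ltW.
  by rewrite (bop0 bT) subrr cnorm0 ltW.
have T0perp x : T x = 0 -> perp x.
  move=> Tx z; have /eqP : cnorm (Q x) = 0 by rewrite QT Tx cnorm0.
  by rewrite cnorm_eq0 => /eqP Qx; rewrite sQ Qx linear0r.
exists U; split.
(* [U] kills every [n] in [perp], so x is orthogonal to [n]. Dropping [n] only shortens x - Q y - n,
   hence ||x|| is near ||Q y|| = ||T y||, which is near ||U x||. *)
- split=> // x xker; apply/eqP; rewrite eq_le Gle//=.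
  apply: (@le_epsM _ 2) => // e e0; have [y [n [nP h1 h2]]] := GU x e e0.
  have xn : dot (x - Q y) (- n) = 0.
    by rewrite linearNr linearBl /= nP (xker _ (Uperp n nP)) subrr oppr0.
  have h3 := le_trans (ler_cnorm_orth xn) h1.
  have h4 := lerB_cnorm x (Q y); have h5 := lerB_cnorm (T y) (U x).
  rewrite cnorm_distC in h5; rewrite QT in h4; lra.
- apply/funext => y /=; apply: Guniq _ (GU _) => e e0; exists y, 0; split.
  + by move=> z; rewrite linear0r.
  + by rewrite !subrr cnorm0 ltW.
  + by rewrite subrr cnorm0 ltW.
(* If U x = 0, then T y and with it Q y is small, and [n] is orthogonal to the range of [Q]; so <Q
   z, x> vanishes for all z, that is, Q x = 0. *)
- move=> x; split=> [Ux|/T0perp/Uperp//].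
  suff Qx : Q x = 0 by apply/eqP; rewrite -cnorm_eq0 -QT Qx cnorm0.
  apply: (dot_extr norm_dot) => z; rewrite linear0r -sQ.
  apply: (@cnorm_eps0 _ _ (2 * cnorm (Q z))) => [|e e0].
    by rewrite mulr_ge0 ?cnorm_ge0.
  have [y [n [nP h1 h2]]] := GU x e e0.
  rewrite Ux sub0r cnormN -QT in h2.
  have -> : dot (Q z) x = dot (Q z) (x - Q y - n) + dot (Q z) (Q y).
    by rewrite !linearBr /= nP; ring.
  rewrite (le_trans (ler_cnormD _ _))//.
  have h3 := cauchy_schwarz norm_dot (Q z) (x - Q y - n).
  have h4 := cauchy_schwarz norm_dot (Q z) (Q y).
  have h5 := ler_wpM2l (cnorm_ge0 (Q z)) h1.
  have h6 := ler_wpM2l (cnorm_ge0 (Q z)) h2.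
  lra.
Qed.

Lemma polar_isometryP T : bounded_op T -> is_polar dot T (polar_isometry dot T).
Proof.
move=> bT; have [saQ QT _] := modulusP bT.
by apply: xgetPex; apply: polar_factor_ex.
Qed.

(** The definition controls [U] only on the orthogonal complement of its kernel, so x is split by
    projecting onto the kernel. *)
Lemma partial_isometry_le U x : partial_isometry dot U -> cnorm (U x) <= cnorm x.
Proof.
move=> [bU isoU].
have [||p [pU xp]] := @orthogonal_projection _ _ _ norm_dot [set y | U y = 0] _ _ x.
- exact: bop0.
- by move=> a y z /= Uy Uz; rewrite (bopD bU) (bopZ bU) Uy Uz scaler0 addr0.
have [K K0 hK] := bop_bound bU.
have Up : U p = 0.
  apply: (@cnorm_eps0 _ _ K (U p) (ltW K0)) => e e0; have [y /= Uy py] := pU e e0.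
  by rewrite -[U p]subr0 -Uy -(bopB bU) (le_trans (hK _))// ler_wpM2l// ltW.
have -> : U x = U (x - p) by rewrite (bopB bU) Up subr0.
rewrite isoU// -[x in leRHS](subrK p); apply: ler_cnorm_orth; exact: xp.
Qed.

(** With W = (A B - z)^-1, the inverse of B A - z is z^-1 (B W A - 1). *)
Lemma invertible_sub_swap A B (z : R[i]) : bounded_op A -> bounded_op B -> z != 0 ->
  invertible (fun x => A (B x) - z *: x) -> invertible (fun x => B (A x) - z *: x).
Proof.
move=> bA bB z0 [bAB [W [bW [AW WA]]]].
have AWE x : A (B (W x)) - z *: W x = x by rewrite -[RHS]/(idfun x) -AW.
have WAE x : W (A (B x) - z *: x) = x by rewrite -[RHS]/(idfun x) -WA.
split; first exact: bop_sub_scalar (bop_comp bB bA).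
exists (fun x => z^-1 *: (B (W (A x)) - x)); split.
  apply: bop_scale; apply: bop_sub; last exact: bop_id.
  exact: (bop_comp bB (bop_comp bW bA)).
split; apply/funext => x /=.
  set w := W (A x); have e : A (B w) = A x + z *: w by rewrite -[A x]AWE subrK.
  rewrite (bopZ bA) (bopZ bB) scalerA mulrC -scalerA -scalerBr.
  rewrite (bopB bA) (bopB bB) e (bopD bB) (bopZ bB) [X in X - _]addrAC subrr add0r.
  by rewrite [z *: (_ - _)]scalerBr opprB addrC subrK scalerA mulVf// scale1r.
rewrite (bopB bA) (bopZ bA) WAE opprB addrA addrAC subrr add0r.
by rewrite scalerA mulVf// scale1r.
Qed.

Variable lam : R.
Hypothesis lam_01 : 0 <= lam <= 1.

Lemma onem_01 : 0 <= 1 - lam <= 1.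
Proof. by have := lam_01; lra. Qed.

Lemma modulus_spectrum T (K : R) : bounded_op T -> 0 <= K ->
  (forall x, cnorm (T x) <= K * cnorm x) ->
  forall t : R, spectrum (modulus dot T) t%:C -> 0 <= t <= K.
Proof.
move=> bT K0 hK; have [[bQ _] QT pQ] := modulusP bT.
by apply: (positive_spectrum_bound norm_dot bQ pQ K0) => x; rewrite QT.
Qed.

Lemma bop_aluthge T : bounded_op T -> bounded_op (aluthge dot lam T).
Proof.
move=> bT; have [K K0 hK] := bop_bound bT; have [saQ _ _] := modulusP bT.
have sK := modulus_spectrum bT (ltW K0) hK; have [[bU _] _ _] := polar_isometryP bT.
apply: bop_comp; last exact: (bop_pow norm_dot H_nonzero saQ K0 sK onem_01).
by apply: bop_comp => //; exact: (bop_pow norm_dot H_nonzero saQ K0 sK lam_01).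
Qed.

Lemma aluthge_norm T (K : R) : bounded_op T -> 0 < K ->
  (forall x, cnorm (T x) <= K * cnorm x) ->
  forall x, cnorm (aluthge dot lam T x) <= K * cnorm x.
Proof.
move=> bT K0 hK x; have [saQ _ _] := modulusP bT.
have sK := modulus_spectrum bT (ltW K0) hK; have [pU _ _] := polar_isometryP bT.
rewrite /aluthge /= (le_trans (op_pow_norm norm_dot H_nonzero saQ K0 sK lam_01 _))//.
have lam1 : lam + (1 - lam) = 1 by rewrite addrC subrK.
have KE : K `^ lam * K `^ (1 - lam) = K.
  by rewrite -powRD lam1 ?powRr1 ?(ltW K0)// oner_eq0.
rewrite -[K in leRHS]KE -mulrA ler_wpM2l ?powR_ge0//.
rewrite (le_trans (partial_isometry_le _ pU))//.
exact: (op_pow_norm norm_dot H_nonzero saQ K0 sK onem_01).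
Qed.

Lemma aluthge_spectrum T (z : R[i]) : bounded_op T -> z != 0 ->
  spectrum T z -> spectrum (aluthge dot lam T) z.
Proof.
move=> bT z0 sz iD; apply: sz; have [K K0 hK] := bop_bound bT.
have [saQ _ _] := modulusP bT; have sK := modulus_spectrum bT (ltW K0) hK.
have [[bU _] TU _] := polar_isometryP bT.
have bP := bop_pow norm_dot H_nonzero saQ K0 sK lam_01.
have bP' := bop_pow norm_dot H_nonzero saQ K0 sK onem_01.
have bUP := bop_comp bU bP'.
have := invertible_sub_swap bP bUP z0 iD; congr invertible; apply/funext => x /=.
congr (_ - _); rewrite [in RHS]TU /=; congr (polar_isometry _ _ _).
rewrite (op_pow_mul norm_dot H_nonzero saQ K0 sK onem_01 lam_01 (u := 1)).
- exact: (op_pow1 norm_dot H_nonzero saQ K0 sK).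
- by rewrite subrK.
- by rewrite ltr01 lexx.
Qed.

Lemma aluthge_iter T (K : R) n : bounded_op T -> 0 < K ->
  (forall x, cnorm (T x) <= K * cnorm x) ->
  bounded_op (iter n (aluthge dot lam) T) /\
  forall x, cnorm (iter n (aluthge dot lam) T x) <= K * cnorm x.
Proof.
move=> bT K0 hK; elim: n => // n [bS hS]; rewrite iterS.
by split; [exact: bop_aluthge|exact: aluthge_norm].
Qed.

Lemma aluthge_iter_spectrum T (z : R[i]) n : bounded_op T -> z != 0 ->
  spectrum T z -> spectrum (iter n (aluthge dot lam) T) z.
Proof.
move=> bT z0 sz; have [K K0 hK] := bop_bound bT.
elim: n => // n IH; rewrite iterS; apply: aluthge_spectrum => //.
by have [] := aluthge_iter n bT K0 hK.
Qed.

End AluthgeTransform.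

(** * Similarity to a near-minimal norm *)

Section Rota.
Context {R : realType} {H : completeNormedModType R[i]}.
Variable dot : {dot H for Num.conj}.
Hypothesis norm_dot : forall x : H, `|x| ^+ 2 = dot x x.
Hypothesis H_nonzero : exists x : H, x != 0.
Implicit Types (S T X : H -> H).

(* [X] is the square root of [\sum_(j <= n) (S^j)^* S^j], so that
   [||X x||^2 = \sum_(j <= n) ||S^j x||^2], a sum which telescopes along [S]. *)
Lemma power_contraction_similar S n : bounded_op S ->
  (forall x, cnorm (iter n.+1 S x) <= cnorm x) ->
  exists2 X, invertible X & forall x, cnorm (X (S x)) <= cnorm (X x).
Proof.
move=> bS Sn; pose P x := \sum_(j < n.+1) (adjoint dot (iter j S) \o iter j S) x.
have bSj j : bounded_op (iter j S) by exact: bop_iter.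
have bP : bounded_op P.
  apply: bop_sum => j; apply: (bop_comp _ (bSj j)).
  exact: (bop_adjoint norm_dot (bSj j)).
have saP : self_adjoint dot P.
  split=> // x y; rewrite /P linear_sumlz linear_sumr; apply: eq_bigr => j _.
  by have [_ sj] := self_adjoint_gram norm_dot (bSj j); exact: sj.
have dotP x : dot (P x) x = (\sum_(j < n.+1) cnorm (iter j S x) ^+ 2)%:C.
  rewrite /P linear_sumlz rmorph_sum; apply: eq_bigr => j _.
  exact: (dot_gram norm_dot x (bSj j)).
have pP x : 0 <= complex.Re (dot (P x) x).
  by rewrite dotP /= sumr_ge0// => j _; rewrite sqr_ge0.
have [[bX sX] XX _] := op_sqrtP norm_dot H_nonzero saP pP.
set X := op_pow P 2^-1 in bX sX XX.
have Xn x : cnorm (X x) ^+ 2 = \sum_(j < n.+1) cnorm (iter j S x) ^+ 2.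
  by apply: (@complexI R); rewrite -(dotxx norm_dot) -sX XX dotP.
have X1 x : 1 * cnorm x <= cnorm (X x).
  rewrite mul1r -(@ler_pXn2r _ 2) ?nnegrE ?cnorm_ge0// Xn big_ord_recl /= lerDl.
  by rewrite sumr_ge0// => j _; rewrite sqr_ge0.
exists X.
  apply: (invertible_dense_range norm_dot bX ltr01 X1) => y Xy.
  apply/eqP; rewrite -cnorm_eq0 eq_le cnorm_ge0 andbT -[cnorm y]mul1r.
  rewrite (le_trans (X1 y))// (_ : X y = 0) ?cnorm0//.
  by apply: (dot_extr norm_dot) => z; rewrite linear0r -sX Xy.
move=> x; rewrite -(@ler_pXn2r _ 2) ?nnegrE ?cnorm_ge0// !Xn.
rewrite big_ord_recr [leRHS]big_ord_recl /= addrC -iterSr lerD//.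
  by rewrite ler_pXn2r ?nnegrE ?cnorm_ge0.
by apply: ler_sum => j _; rewrite -iterSr.
Qed.

Lemma rota T (rho : R) : bounded_op T -> spectral_radius T < rho ->
  exists2 X, invertible X &
    forall y, cnorm ((X \o T \o op_inv X) y) <= rho * cnorm y.
Proof.
move=> bT Trho; have r0 := spectral_radius_ge0 norm_dot H_nonzero bT.
have rho0 : 0 < rho := le_lt_trans r0 Trho.
have inv z : cnorm z <= rho^-1 -> invertible (fun x => x - z *: T x).
  have [-> _|z0 zr] := eqVneq z 0; first by rewrite one_sub0; exact: invertible_id.
  apply: invertible_one_sub => /(spectral_radius_ub norm_dot H_nonzero bT).
  have zp : 0 < cnorm z by rewrite lt_def cnorm_eq0 z0 cnorm_ge0.
  rewrite cnormV leNgt (lt_le_trans Trho)//.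
  by rewrite -[rho]invrK lef_pV2 ?posrE ?invr_gt0.
have ri : 0 <= rho^-1 by rewrite invr_ge0 ltW.
have [k hk] := contraction_power bT ri inv.
have bS : bounded_op (fun x => rho^-1%:C *: T x) by exact: bop_scale.
have [x|X iX XS] := @power_contraction_similar _ (2 ^ k).-1 bS.
  rewrite prednK ?expn_gt0//; by rewrite (le_trans (hk x))// ler_piMl ?cnorm_ge0//; lra.
exists X => // y /=; have [bX _] := iX; have := XS (op_inv X y).
rewrite op_invKV// (bopZ bX) cnormZ cnorm_real ger0_norm//.
by rewrite mulrC ler_pdivrMr// mulrC.
Qed.

Lemma spectrum_similar T X (a z : R[i]) : bounded_op T -> invertible X -> a != 0 ->
  spectrum T z -> spectrum (fun x => a *: (X \o T \o op_inv X) x) (a * z).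
Proof.
move=> bT iX a0 sz iS; apply: sz; have [bX _] := iX.
have ai : a^-1 != 0 by rewrite invr_eq0.
have := invertible_scale ai
  (invertible_comp (invertible_inv iX) (invertible_comp iS iX)).
congr invertible; apply/funext => x /=; have bY := bop_inv iX.
rewrite op_invK// (bopB bY) !(bopZ bY) !op_invK// scalerBr !scalerA mulVf//.
by rewrite scale1r mulrA mulVf// mul1r.
Qed.

End Rota.

(** * Numerical radius and real part *)

Section NumericalRadius.
Context {R : realType} {H : completeNormedModType R[i]}.
Variable dot : {dot H for Num.conj}.
Hypothesis norm_dot : forall x : H, `|x| ^+ 2 = dot x x.
Hypothesis H_nonzero : exists x : H, x != 0.
Implicit Types (D S : H -> H).

Lemma unit_vector : exists u : H, cnorm u = 1.
Proof.
have [x x0] := H_nonzero; exists ((cnorm x)^-1%:C *: x).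
have n0 : 0 < cnorm x by rewrite lt_def cnorm_eq0 x0 cnorm_ge0.
by rewrite cnormZ cnorm_real ger0_norm ?invr_ge0 ?(ltW n0)// mulVf// gt_eqF.
Qed.

Lemma numerical_radius_has_sup S : bounded_op S ->
  has_sup [set cnorm mu | mu in numerical_range dot S].
Proof.
move=> bS; split.
  have [u u1] := unit_vector; exists (cnorm (dot (S u) u)), (dot (S u) u) => //.
  by exists u.
have [K K0 hK] := bop_bound bS; exists K => _ [_ [x /= x1 <-] <-].
rewrite (le_trans (cauchy_schwarz norm_dot _ _))// x1 mulr1.
by rewrite (le_trans (hK x))// x1 mulr1.
Qed.

Lemma numerical_radius_ub S x : bounded_op S ->
  cnorm (dot (S x) x) <= numerical_radius dot S * cnorm x ^+ 2.
Proof.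
move=> bS; have [->|x0] := eqVneq x 0.
  by rewrite linear0r !cnorm0 expr0n mulr0.
have n0 : 0 < cnorm x by rewrite lt_def cnorm_eq0 x0 cnorm_ge0.
have n2 : 0 < cnorm x ^+ 2 by rewrite exprn_gt0.
rewrite -ler_pdivrMr//; apply: ub_le_sup; first by case: (numerical_radius_has_sup bS).
pose y := (cnorm x)^-1%:C *: x; exists (dot (S y) y).
  exists y => //=; rewrite cnormZ cnorm_real ger0_norm ?invr_ge0 ?(ltW n0)//.
  by rewrite mulVf// gt_eqF.
rewrite /y (bopZ bS) dotZl dotZr conjc_real !cnormM cnorm_real.
by rewrite ger0_norm ?invr_ge0 ?(ltW n0)//; field; rewrite gt_eqF.
Qed.

Lemma numerical_radius_le_opnorm S : bounded_op S -> numerical_radius dot S <= opnorm S.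
Proof.
move=> bS; apply: ge_sup; first by case: (numerical_radius_has_sup bS).
move=> _ [_ [x /= x1 <-] <-]; rewrite (le_trans (cauchy_schwarz norm_dot _ _))//.
by rewrite x1 mulr1 (le_trans (ler_opnorm x bS))// x1 mulr1.
Qed.

Lemma bop_re_op S : bounded_op S -> bounded_op (re_op dot S).
Proof.
by move=> bS; apply: bop_scale; apply: bop_add => //; exact: bop_adjoint.
Qed.

Lemma dot_re_op S x : bounded_op S ->
  dot (re_op dot S x) x = (complex.Re (dot (S x) x))%:C.
Proof.
move=> bS; rewrite /re_op linearZl_LR linearDl /= [dot (adjoint _ _ _) _]dotC.
by rewrite -(adjointP norm_dot)// addcJ mulrA mulVf ?mul1r// pnatr_eq0.
Qed.

Lemma re_op_norm S (K : R) : bounded_op S -> 0 <= K ->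
  (forall x, cnorm (S x) <= K * cnorm x) -> opnorm (re_op dot S) <= K.
Proof.
move=> bS K0 hK; apply: opnorm_le => // x.
(* With y the image of x under the adjoint, ||y||^2 = <S y, x> <= K ||y|| ||x||. *)
have adjK : cnorm (adjoint dot S x) <= K * cnorm x.
  set y := adjoint dot S x; have [->|y0] := eqVneq y 0.
    by rewrite cnorm0 mulr_ge0 ?cnorm_ge0.
  have n0 : 0 < cnorm y by rewrite lt_def cnorm_eq0 y0 cnorm_ge0.
  rewrite -(ler_pM2l n0) -expr2 -[leLHS]ger0_norm ?sqr_ge0// -cnorm_real.
  rewrite -(dotxx norm_dot) {2}/y -(adjointP norm_dot)//.
  rewrite (le_trans (cauchy_schwarz norm_dot _ _))// mulrA [cnorm y * _]mulrC.
  by rewrite ler_wpM2r ?cnorm_ge0.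
rewrite /re_op cnormZ cnormV (_ : cnorm 2 = 2); last first.
  by rewrite -(rmorph_nat (real_complex R)) cnorm_real ger0_norm.
rewrite mulrC ler_pdivrMr// (le_trans (ler_cnormD _ _))//.
by have := hK x; lra.
Qed.

Lemma spectrum_le_numerical_radius D (r : R) : bounded_op D ->
  spectrum D r%:C -> r <= numerical_radius dot (re_op dot D).
Proof.
move=> bD sr; rewrite leNgt; apply/negP => wr; apply: sr.
set w := numerical_radius _ _ in wr; have rw : 0 < r - w by rewrite subr_gt0.
apply: (lax_milgram norm_dot (bop_sub_scalar r%:C bD) rw) => x.
have := numerical_radius_ub x (bop_re_op bD); rewrite dot_re_op// cnorm_real -/w.
move=> /(le_trans (ler_norm _)) h.
have -> : dot (D x - r%:C *: x) x = dot (D x) x - (r * cnorm x ^+ 2)%:C.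
  by rewrite linearBl /= dotZl (dotxx norm_dot) -rmorphM.
rewrite cnorm_distC.
rewrite (le_trans _ (Re_le_cnorm _))// ReD ReN [complex.Re _%:C]/=; lra.
Qed.

Lemma numerical_radius_ge0 S : bounded_op S -> 0 <= numerical_radius dot S.
Proof.
move=> bS; have [u u1] := unit_vector.
have := numerical_radius_ub u bS; rewrite u1 expr1n mulr1.
exact: le_trans (cnorm_ge0 _).
Qed.

End NumericalRadius.

(** * The two infima *)

Lemma eq_inf_image (R : realType) (I : Type) (A : set I) (f : I -> R) (r : R) :
  A !=set0 -> (forall i, A i -> r <= f i) ->
  (forall rho, r < rho -> exists2 i, A i & f i <= rho) ->
  r = inf [set f i | i in A].
Proof.
move=> [i0 Ai0] lb ub; apply/eqP; rewrite eq_le; apply/andP; split.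
  apply: lb_le_inf; first by exists (f i0); exists i0.
  by move=> _ [i Ai <-]; exact: lb.
apply/ler_addgt0Pr => e e0; have [|i Ai fi] := ub (r + e); first by rewrite ltrDl.
apply: le_trans fi; apply: ge_inf; last by exists i.
by exists r => _ [j Aj <-]; exact: lb.
Qed.

Theorem theorem3p2 (R : realType) (H : completeNormedModType R[i])
    (dot : {dot H for Num.conj})
    (norm_dot : forall x : H, `|x| ^+ 2 = dot x x)
    (H_nonzero : exists x : H, x != 0)
    (lam : R) (lam_01 : 0 <= lam <= 1)
    (T : H -> H) (T_bounded : bounded_op T) :
  exists theta : R, forall n : nat,
    spectral_radius T =
      inf [set numerical_radius dot (re_op dot
             (iter n (aluthge dot lam)
               (fun x => expi theta *: (X \o T \o op_inv X) x)))
          | X in invertible] /\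
    spectral_radius T =
      inf [set opnorm (re_op dot
             (iter n (aluthge dot lam)
               (fun x => expi theta *: (X \o T \o op_inv X) x)))
          | X in invertible].
Proof.
have [z sz zr] := spectral_radius_attained norm_dot H_nonzero T_bounded.
have [t _ zE] := polar_form z; exists (- t) => n.
set r := spectral_radius T in zr *.
pose S X := fun x => expi (- t) *: (X \o T \o op_inv X) x.
pose D X := iter n (aluthge dot lam) (S X).
have e0 : expi (- t) != 0 by rewrite -cnorm_eq0 cnorm_expi oner_eq0.
have r0 : 0 <= r by exact: spectral_radius_ge0.
have bS X : invertible X -> bounded_op (S X).
  move=> iX; have [bX _] := iX; apply: bop_scale.
  exact: (bop_comp (bop_comp bX T_bounded) (bop_inv iX)).
have bD X : invertible X -> bounded_op (D X).
  move=> iX; have [K K0 hK] := bop_bound (bS X iX).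
  by have [] := aluthge_iter norm_dot H_nonzero lam_01 n (bS X iX) K0 hK.
have lower X : invertible X -> r <= numerical_radius dot (re_op dot (D X)).
  (* Passing from A B to B A preserves only nonzero spectral values, hence the separate case r = 0,
     where nonnegativity of the numerical radius suffices. *)
  move=> iX; have [r_eq0|rn0] := eqVneq r 0.
    rewrite r_eq0; apply: (numerical_radius_ge0 norm_dot H_nonzero).
    exact: (bop_re_op norm_dot (bD X iX)).
  apply: spectrum_le_numerical_radius => //; first exact: bD.
  apply: aluthge_iter_spectrum => //; first exact: bS.
    by rewrite -cnorm_eq0 cnorm_real normr_eq0.
  have -> : r%:C = expi (- t) * z by rewrite zE zr mulrCA expiV mulr1.
  exact: spectrum_similar.
have mid X : invertible X ->
    numerical_radius dot (re_op dot (D X)) <= opnorm (re_op dot (D X)).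
  move=> iX; apply: numerical_radius_le_opnorm => //.
  exact: (bop_re_op norm_dot (bD X iX)).
have upper rho : r < rho ->
    exists2 X, invertible X & opnorm (re_op dot (D X)) <= rho.
  move=> rrho; have [X iX hX] := rota norm_dot H_nonzero T_bounded rrho.
  exists X => //; have rho0 : 0 < rho := le_lt_trans r0 rrho.
  have hS x : cnorm (S X x) <= rho * cnorm x.
    by rewrite /S cnormZ cnorm_expi mul1r hX.
  have [b h] := aluthge_iter norm_dot H_nonzero lam_01 n (bS X iX) rho0 hS.
  exact: re_op_norm (ltW rho0) h.
have inv0 : @invertible R H !=set0 by exists idfun; exact: invertible_id.
split; apply: (eq_inf_image inv0).
- exact: lower.
- move=> rho rrho; have [X iX hX] := upper rho rrho; exists X => //.
  exact: le_trans (mid X iX) hX.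
- by move=> X iX; exact: le_trans (lower X iX) (mid X iX).
- exact: upper.
Qed.
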